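(* Let $\mathcal{D}$ be a bounded domain in a complex Banach space $X$, let $\mathcal{A}$ be a complex unital Banach algebra, and let $\mathcal{F}=\{F_t\}_{t\ge0}\subset\mathrm{Hol}(\mathcal{D})$ be a $T$-continuous semigroup on $\mathcal{D}$. Then a semicocycle $\{\Gamma_t\}_{t\ge0}\subset\mathrm{Hol}(\mathcal{D},\mathcal{A})$ over $\mathcal{F}$ is generated by a mapping $B\in\mathrm{Hol}(\mathcal{D},\mathcal{A})$ if and only if it is uniformly jointly continuous.
   Context: $\mathrm{Hol}(\mathcal{D},Y)$ is the set of holomorphic (everywhere complex Fréchet differentiable) maps $\mathcal{D}\to Y$, and $\mathrm{Hol}(\mathcal{D})$ the set of holomorphic self-maps of $\mathcal{D}$. The unit satisfies $\|1_{\mathcal{A}}\|=1$. Semigroup on $\mathcal{D}$: a family $\{F_t\}_{t\ge0}$ of continuous self-maps of $\mathcal{D}$ with (i) $F_{t+s}=F_t\circ F_s$ for all $t,s\ge 0$; (ii) $\lim_{t\to0^+}F_t(x)=x$ for every $x\in\mathcal{D}$. Semicocycle over $\{F_t\}$: a family of maps $\Gamma_t:\mathcal{D}\to\mathcal{A}$, $t\ge0$, with (a) $\Gamma_t(F_s(x))\Gamma_s(x)=\Gamma_{t+s}(x)$ for all $t,s\ge0$, $x\in\mathcal{D}$; (b) $\lim_{t\to0^+}\Gamma_t(x)=1_{\mathcal{A}}$ for every $x\in\mathcal{D}$. The semicocycle is generated by $B$ if, for every $x\in\mathcal{D}$, $t\mapsto\Gamma_t(x)$ is differentiable on $[0,\infty)$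 and solves $\frac{d}{dt}v(t,x)=B(F_t(x))v(t,x)$, $v(0,x)=1_{\mathcal{A}}$ (so $B(x)=\frac{d}{dt}\Gamma_t(x)|_{t=0}$). A bounded subset $\mathcal{D}^*\subset\mathcal{D}$ lies strictly inside $\mathcal{D}$ if $\inf_{x\in\mathcal{D}^*}\mathrm{dist}(x,\partial\mathcal{D})>0$. A family $\{f_t\}_{t\ge0}$ of continuous maps from $\mathcal{D}$ to a Banach space $Y$ is: $T$-continuous if for every $t_0\ge0$ and every $\mathcal{D}^*$ strictly inside $\mathcal{D}$, $\sup_{x\in\mathcal{D}^*}\|f_t(x)-f_{t_0}(x)\|_Y\to0$ as $t\to t_0$; uniformly jointly continuous if for every $t_0\ge0$ and $x_0\in\mathcal{D}$ there is a neighborhood $U$ of $x_0$ such that $f_t(x)\to f_{t_0}(x)$ as $t\to t_0$, uniformly on $U$. *)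

(* Defs.v *)
From Stdlib Require Export Reals.
From Coquelicot Require Export Coquelicot.

Open Scope R_scope.

(** Complex Banach spaces are Coquelicot's [CompleteNormedModule C_AbsRing].
    Coquelicot's [norm] is only required to be sub-homogeneous, which over a
    field is the same as homogeneous. *)
Notation BanachSpace := (CompleteNormedModule C_AbsRing).

(** The additive structure in [ring_mixin] is that of the Banach space, so
    only the multiplication and the unit are new data. *)
Record UnitalBanachAlgebra := {
  banach_space :> BanachSpace;
  ring_mixin : Ring.mixin_of (CompleteNormedModule.AbelianGroup C_AbsRing banach_space);
  scal_mult_l : forall (k : C) (a b : banach_space),
    Ring.mult _ ring_mixin (scal k a) b = scal k (Ring.mult _ ring_mixin a b);
  scal_mult_r : forall (k : C) (a b : banach_space),
    Ring.mult _ ring_mixin a (scal k b) = scal k (Ring.mult _ ring_mixin a b);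
  norm_mult : forall a b : banach_space,
    norm (Ring.mult _ ring_mixin a b) <= norm a * norm b;
  norm_unit : norm (Ring.one _ ring_mixin : banach_space) = 1
}.

Definition amul {A : UnitalBanachAlgebra} (a b : A) : A :=
  Ring.mult _ (ring_mixin A) a b.

Definition aone {A : UnitalBanachAlgebra} : A := Ring.one _ (ring_mixin A).

Section Domains.

Context {X : BanachSpace}.

Definition connected_set (D : X -> Prop) : Prop :=
  forall U V : X -> Prop,
    open U -> open V ->
    (forall x, D x -> U x \/ V x) ->
    (exists x, D x /\ U x) -> (exists x, D x /\ V x) ->
    exists x, D x /\ U x /\ V x.

Definition domain (D : X -> Prop) : Prop :=
  (exists x, D x) /\ open D /\ connected_set D.

Definition bounded_set (E : X -> Prop) : Prop :=
  exists M : R, forall x, E x -> norm x <= M.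

Definition boundary (D : X -> Prop) (x : X) : Prop :=
  forall P : X -> Prop, locally x P ->
    (exists y, P y /\ D y) /\ (exists y, P y /\ ~ D y).

(** Equals [p_infty] when [S] is empty. *)
Definition dist (x : X) (S : X -> Prop) : Rbar :=
  Glb_Rbar (fun r => exists y, S y /\ r = norm (minus x y)).

Definition strictly_inside (D E : X -> Prop) : Prop :=
  (forall x, E x -> D x) /\ bounded_set E /\
  Rbar_lt 0 (Rbar_glb (fun r => exists x, E x /\ r = dist x (boundary D))).

(** Maps with domain [D] are represented by total functions on [X] whose
    values outside [D] are never used: [D] is open in all uses, so [locally x]
    with [D x] only sees the restriction to [D]. *)
Definition holomorphic {Y : BanachSpace} (D : X -> Prop) (f : X -> Y) : Prop :=
  forall x, D x -> ex_filterdiff f (locally x).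

(** Families are indexed by [t >= 0] and represented by functions on all of
    [R]; [at_time t0] is the filter of [t -> t0] with [t >= 0]. *)
Definition at_time (t0 : R) : (R -> Prop) -> Prop :=
  within (fun t => 0 <= t) (locally t0).

(** [sup_{x in E} |f_t x - f_{t0} x| -> 0] as [t -> t0], with the supremum over
    the empty set read as [0]. *)
Definition uniform_limit_on {Y : BanachSpace}
    (f : R -> X -> Y) (t0 : R) (E : X -> Prop) : Prop :=
  forall eps : posreal,
    at_time t0 (fun t => forall x, E x -> norm (minus (f t x) (f t0 x)) <= eps).

Definition T_continuous {Y : BanachSpace}
    (D : X -> Prop) (f : R -> X -> Y) : Prop :=
  (forall t, 0 <= t -> forall x, D x -> continuous (f t) x) /\
  forall t0, 0 <= t0 -> forall E, strictly_inside D E -> uniform_limit_on f t0 E.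

Definition uniformly_jointly_continuous {Y : BanachSpace}
    (D : X -> Prop) (f : R -> X -> Y) : Prop :=
  (forall t, 0 <= t -> forall x, D x -> continuous (f t) x) /\
  forall t0 x0, 0 <= t0 -> D x0 ->
    exists U : X -> Prop,
      locally x0 U /\ (forall x, U x -> D x) /\ uniform_limit_on f t0 U.

Definition self_map (D : X -> Prop) (f : X -> X) : Prop :=
  forall x, D x -> D (f x).

Definition semigroup (D : X -> Prop) (F : R -> X -> X) : Prop :=
  (forall t, 0 <= t -> self_map D (F t)) /\
  (forall t, 0 <= t -> forall x, D x -> continuous (F t) x) /\
  (forall t s, 0 <= t -> 0 <= s -> forall x, D x -> F (t + s) x = F t (F s x)) /\
  (forall x, D x -> filterlim (fun t => F t x) (at_right 0) (locally x)).

Definition semicocycle {A : UnitalBanachAlgebra}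
    (D : X -> Prop) (F : R -> X -> X) (Gamma : R -> X -> A) : Prop :=
  (forall t s, 0 <= t -> 0 <= s -> forall x, D x ->
     amul (Gamma t (F s x)) (Gamma s x) = Gamma (t + s) x) /\
  (forall x, D x -> filterlim (fun t => Gamma t x) (at_right 0) (locally aone)).

End Domains.

(** Derivative at [t >= 0] of a map on [[0, +oo)]: two-sided if [t > 0],
    one-sided if [t = 0]. *)
Definition is_derive_halfline {Y : BanachSpace} (v : R -> Y) (t : R) (l : Y) : Prop :=
  filterlim (fun s => scal (RtoC (/ (s - t))) (minus (v s) (v t)))
    (within (fun s => 0 <= s) (locally' t)) (locally l).

Definition generated_by {X : BanachSpace} {A : UnitalBanachAlgebra}
    (D : X -> Prop) (F : R -> X -> X) (Gamma : R -> X -> A) (B : X -> A) : Prop :=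
  forall x, D x ->
    Gamma 0 x = aone /\
    forall t, 0 <= t ->
      is_derive_halfline (fun s => Gamma s x) t (amul (B (F t x)) (Gamma t x)).

(* Main.v *)
Require Import Defs.
From Stdlib Require Import Lra Lia List Classical ClassicalEpsilon.

(** Near a point of [D], put [a t x := (F_t x - x, Gamma_t x - 1)] in [X * A].
    The semigroup and cocycle identities express the additive defect
    [a (t + s) x - a t x - a s x] through [a t (F_s x) - a t x], so the Cauchy
    estimates, which make [a t] Lipschitz with a constant proportional to its
    supremum on a larger ball, bound the defect by [C * sup |a t| * |a s x|].
    If [a] is uniformly small for small [t], halving the time repeatedly gives
    [|a t x| <= K t]; the defect is then [O (t s)], and [a t x / t] converges at
    rate [O (t)], uniformly in [x].  Its [A]-component [B] is holomorphic as a
    local uniform limit of holomorphic maps, and the cocycle identity turns the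
    derivative at [0] into the differential equation.

    Conversely, a Gronwall estimate where [B] is bounded shows
    [Gamma_t -> 1] locally uniformly as [t -> 0], and the cocycle identity
    carries this to every [t0].

    The Cauchy estimate is obtained without integrals: Goursat's bisection is
    applied to midpoint Riemann sums over the boundary of a rectangle, and the
    rectangle is mapped by the exponential to an annulus around [0]. *)

(** * Linear identities in complex vector spaces *)

(** Only continuity in [t] is known of the semigroup, while the defect of [Gamma_t - 1] contains the
    Lipschitz constant of [Gamma_t] times [|F_s x - x|]. Linear growth of the second component
    therefore needs linear growth of the first, and pairing them yields both from one inequality.
    Holomorphy makes the scheme close: the Lipschitz constant shrinks together with [a t], so the
    defect is of second order.

    The obstacle is that every Cauchy estimate costs a part of the ball, so the domain must not
    shrink at each of infinitely many halvings. Each pass of halvings therefore treats all scales at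
    once, using a bound for [a t] already known on a fixed larger ball. A first pass with a merely
    small constant bound gives only the decay [(2/3)^k] at time [t / 2^k]; a second pass, fed with
    this decay, has summable errors and gives the true rate [2^(-k)]. The additivity estimate costs
    one more reduction, hence the radii [r], [r/4], [r/16], [r/64]. The algebra need not be
    commutative, so the order of the factors in the cocycle identity is kept throughout. *)

Inductive mexp : Type :=
| MVar (n : nat)
| MZero
| MPlus (e1 e2 : mexp)
| MOpp (e : mexp)
| MScal (k : C) (e : mexp).

Fixpoint mcoef (e : mexp) (i : nat) : C :=
  match e with
  | MVar n => if Nat.eqb n i then 1%C else 0%C
  | MZero => 0%C
  | MPlus e1 e2 => (mcoef e1 i + mcoef e2 i)%C
  | MOpp e => (- mcoef e i)%C
  | MScal k e => (k * mcoef e i)%C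
  end.

(** Recursion on the number of atoms instead of a bounded quantifier: reduction unfolds it into a
    finite conjunction of scalar equations. *)
Fixpoint eq_upto (c d : nat -> C) (n : nat) : Prop :=
  match n with
  | O => True
  | S n => c O = d O /\ eq_upto (fun i => c (S i)) (fun i => d (S i)) n
  end.

Section ModuleExpressions.
Context {Y : NormedModule C_AbsRing}.

Fixpoint meval (env : list Y) (e : mexp) : Y :=
  match e with
  | MVar n => nth n env zero
  | MZero => zero
  | MPlus e1 e2 => plus (meval env e1) (meval env e2)
  | MOpp e => opp (meval env e)
  | MScal k e => scal (k : C_AbsRing) (meval env e)
  end.

Fixpoint lincomb (env : list Y) (c : nat -> C) : Y :=
  match env with
  | nil => zero
  | y :: env => plus (scal (c O : C_AbsRing) y) (lincomb env (fun i => c (S i)))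
  end.

Lemma lincomb_zero (env : list Y) (c : nat -> C) :
  (forall i, c i = 0%C) -> lincomb env c = zero.
Proof.
  revert c; induction env as [|y env IH]; intros c Hc; simpl; [easy|].
  rewrite Hc, IH by (intros; apply Hc).
  rewrite plus_zero_r. exact (scal_zero_l y).
Qed.

Lemma lincomb_plus (env : list Y) (c d : nat -> C) :
  lincomb env (fun i => (c i + d i)%C) = plus (lincomb env c) (lincomb env d).
Proof.
  revert c d; induction env as [|y env IH]; intros c d; simpl.
  - now rewrite plus_zero_r.
  - rewrite (IH (fun i => c (S i)) (fun i => d (S i))).
    etransitivity;
      [apply f_equal2; [exact (scal_distr_r (c O : C_AbsRing) (d O : C_AbsRing) y)|reflexivity]|].
    rewrite <- !plus_assoc. f_equal. rewrite !plus_assoc. f_equal. apply plus_comm.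
Qed.

Lemma lincomb_scal (env : list Y) (k : C) (c : nat -> C) :
  lincomb env (fun i => (k * c i)%C) = scal (k : C_AbsRing) (lincomb env c).
Proof.
  revert c; induction env as [|y env IH]; intros c; simpl.
  - symmetry; exact (scal_zero_r (V := Y) (k : C_AbsRing)).
  - rewrite (IH (fun i => c (S i))), scal_distr_l.
    f_equal. symmetry. exact (scal_assoc (k : C_AbsRing) (c O : C_AbsRing) y).
Qed.

Lemma lincomb_ext (env : list Y) (c d : nat -> C) :
  eq_upto c d (length env) -> lincomb env c = lincomb env d.
Proof.
  revert c d; induction env as [|y env IH]; intros c d H; simpl; [easy|].
  destruct H as [H0 H]. rewrite H0. f_equal. now apply IH.
Qed.

Lemma lincomb_ext_all (env : list Y) (c d : nat -> C) :
  (forall i, c i = d i) -> lincomb env c = lincomb env d.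
Proof.
  revert c d; induction env as [|y env IH]; intros c d H; simpl; [easy|].
  rewrite H. f_equal. apply IH; intros; apply H.
Qed.

Lemma meval_lincomb (env : list Y) (e : mexp) : meval env e = lincomb env (mcoef e).
Proof.
  induction e as [n| |e1 IH1 e2 IH2|e IH|k e IH]; cbn [meval].
  - revert n; induction env as [|y env IH]; intros [|n]; simpl; try easy.
    + rewrite lincomb_zero by easy. rewrite plus_zero_r. symmetry; exact (scal_one y).
    + rewrite IH. etransitivity; [symmetry; apply plus_zero_l|].
      apply f_equal2; [symmetry; exact (scal_zero_l y)|]. now apply lincomb_ext_all.
  - symmetry; now apply lincomb_zero.
  - rewrite IH1, IH2. symmetry. exact (lincomb_plus env (mcoef e1) (mcoef e2)).
  - rewrite IH. etransitivity; [symmetry; exact (scal_opp_one (lincomb env (mcoef e)))|].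
    etransitivity; [symmetry; exact (lincomb_scal env (- (1))%C (mcoef e))|].
    apply lincomb_ext_all; intros i; simpl; ring.
  - rewrite IH. symmetry. exact (lincomb_scal env k (mcoef e)).
Qed.

Lemma meval_eq (env : list Y) (e1 e2 : mexp) :
  eq_upto (mcoef e1) (mcoef e2) (length env) -> meval env e1 = meval env e2.
Proof. intros H. rewrite !meval_lincomb. now apply lincomb_ext. Qed.
End ModuleExpressions.

Ltac find_atom t env :=
  match env with
  | cons t _ => constr:(O)
  | cons _ ?env' => let n := find_atom t env' in constr:(S n)
  end.

(** Failure of [find_atom] in the first branch selects the second. New atoms go in front and shift
    the older indices, so both sides of an equation are scanned completely before either is
    reified. *)
Ltac add_atom t env :=
  match env with
  | _ => let n := find_atom t env in env
  | _ => constr:(cons t env)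
  end.

Ltac module_atoms t env :=
  lazymatch t with
  | plus ?a ?b => let env := module_atoms a env in module_atoms b env
  | minus ?a ?b => let env := module_atoms a env in module_atoms b env
  | opp ?a => module_atoms a env
  | scal _ ?a => module_atoms a env
  | zero => env
  | _ => add_atom t env
  end.

Ltac module_reify t env :=
  lazymatch t with
  | plus ?a ?b => let a := module_reify a env in let b := module_reify b env in
      constr:(MPlus a b)
  | minus ?a ?b => let a := module_reify a env in let b := module_reify b env in
      constr:(MPlus a (MOpp b))
  | opp ?a => let a := module_reify a env in constr:(MOpp a)
  | scal ?k ?a => let a := module_reify a env in constr:(MScal k a)
  | zero => constr:(MZero)
  | _ => let n := find_atom t env in constr:(MVar n)
  end.

(** Equations between linear combinations over [C], reduced to equations
    between coefficients. *)
Ltac module_eq_in Y :=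
  match goal with
  | |- ?a = ?b =>
      let env := module_atoms a (@nil (NormedModule.sort C_AbsRing Y)) in
      let env := module_atoms b env in
      let ea := module_reify a env in
      let eb := module_reify b env in
      change (meval (Y := Y) env ea = meval env eb);
      apply meval_eq; cbn [eq_upto length mcoef Nat.eqb]; repeat split
  end.
Ltac module_eq Y := module_eq_in Y; try (now ring); try field.

(** The supremum of the times up to which [P] holds is itself such a time by the limit clause, and
    cannot lie below [T] by the step clause. This form of induction stands in for the mean value
    inequality: the Lipschitz bound along a segment and the Gronwall estimate both rest on it. *)
Lemma real_induction (P : R -> Prop) (T : R) :
  P 0 ->
  (forall t, 0 <= t < T -> (forall s, 0 <= s <= t -> P s) ->
     exists d, 0 < d /\ forall h, 0 < h < d -> P (t + h)) ->
  (forall t, 0 < t <= T -> (forall s, 0 <= s < t -> P s) -> P t) ->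
  forall t, 0 <= t <= T -> P t.
Proof.
  intros H0 Hstep Hlim t Ht.
  set (E := fun u => 0 <= u <= T /\ forall s, 0 <= s <= u -> P s).
  assert (E0 : E 0).
  { split; [lra|]. intros s Hs. now replace s with 0 by lra. }
  destruct (completeness E) as [m [Hub Hleast]].
  { exists T. intros u [Hu _]. lra. }
  { now exists 0. }
  assert (Hm0 : 0 <= m) by now apply Hub.
  assert (HmT : m <= T) by (apply Hleast; intros u [Hu _]; lra).
  assert (Hbelow : forall s, 0 <= s < m -> P s).
  { intros s Hs. apply NNPP; intros Hn.
    assert (m <= s); [|lra].
    apply Hleast. intros u [Hu1 Hu2]. destruct (Rle_dec u s) as [|Hus]; [easy|].
    exfalso; apply Hn, Hu2; lra. }
  assert (Hm : forall s, 0 <= s <= m -> P s).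
  { intros s Hs. destruct (Rlt_dec s m); [apply Hbelow; lra|].
    replace s with m by lra. destruct (Req_dec m 0) as [->|]; [easy|].
    apply Hlim; [lra|easy]. }
  destruct (Rlt_dec m T) as [HmT'|]; [|apply Hm; lra].
  destruct (Hstep m) as [d [Hd HPd]]; [lra|easy|].
  exfalso.
  set (h := Rmin (d / 2) (T - m)).
  assert (Hh : 0 < h) by (apply Rmin_glb_lt; lra).
  assert (h <= d / 2) by apply Rmin_l. assert (h <= T - m) by apply Rmin_r.
  assert (E (m + h)).
  { split; [lra|]. intros s Hs. destruct (Rle_dec s m); [apply Hm; lra|].
    replace s with (m + (s - m)) by ring. apply HPd; lra. }
  assert (m + h <= m) by now apply Hub. lra.
Qed.

(** * Goursat's lemma for midpoint sums *)

Ltac C_eq := apply injective_projections; simpl; field.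

Lemma dependent_choice {T : Type} (P : nat -> T -> Prop) (Q : nat -> T -> T -> Prop) (x0 : T) :
  P O x0 ->
  (forall k x, P k x -> exists y, Q k x y /\ P (S k) y) ->
  exists u : nat -> T, u O = x0 /\ forall k, P k (u k) /\ Q k (u k) (u (S k)).
Proof.
  intros H0 Hstep.
  set (next := fun k x => epsilon (inhabits x0) (fun y => Q k x y /\ P (S k) y)).
  set (u := nat_rect (fun _ => T) x0 next).
  assert (Hnext : forall k, P k (u k) -> Q k (u k) (u (S k)) /\ P (S k) (u (S k))).
  { intros k Hk. apply (epsilon_spec (inhabits x0) (fun y => Q k (u k) y /\ P (S k) y)).
    now apply Hstep. }
  assert (HP : forall k, P k (u k)).
  { intros k; induction k as [|k IH]; [easy|now apply Hnext]. }
  exists u. split; [easy|]. intros k. split; [apply HP|apply Hnext, HP].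
Qed.

Section Goursat.
Context {Y : NormedModule C_AbsRing}.

Lemma norm_scal_C (k : C) (y : Y) : norm (scal (k : C_AbsRing) y) <= Cmod k * norm y.
Proof. exact (norm_scal (k : C_AbsRing) y). Qed.

Lemma norm_le_plus (a b c : Y) : c = plus a b -> norm c <= norm a + norm b.
Proof. intros ->. apply norm_triangle. Qed.

Lemma norm_minus_sym (x y : Y) : norm (minus x y) = norm (minus y x).
Proof. rewrite <- norm_opp. f_equal. module_eq Y. Qed.

Lemma norm_minus_triangle (x y z : Y) :
  norm (minus x z) <= norm (minus x y) + norm (minus y z).
Proof.
  replace (minus x z) with (plus (minus x y) (minus y z)) by module_eq Y.
  apply norm_triangle.
Qed.

Lemma norm_minus_le_trans (x y z : Y) (a b : R) :
  norm (minus x y) <= a -> norm (minus y z) <= b -> norm (minus x z) <= a + b.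
Proof. intros Ha Hb. pose proof (norm_minus_triangle x y z). lra. Qed.

Lemma norm_minus_le (x y : Y) : norm (minus x y) <= norm x + norm y.
Proof. unfold minus. rewrite <- (norm_opp y). apply norm_triangle. Qed.

Lemma norm_le_minus (x y : Y) : norm x <= norm (minus x y) + norm y.
Proof.
  replace x with (plus (minus x y) y) at 1 by module_eq Y.
  apply norm_triangle.
Qed.

(** The composite midpoint rule with [2 ^ n] pieces for the integral of [h] from [z] to [z + d]. The
    recursion halves the segment, so bisecting a rectangle is an exact identity between levels [S n]
    and [n]. *)
Fixpoint edge (n : nat) (h : C -> Y) (z d : C) : Y :=
  match n with
  | O => scal (d : C_AbsRing) (h (z + d / 2)%C)
  | S n => plus (edge n h z (d / 2)%C) (edge n h (z + d / 2)%C (d / 2)%C)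
  end.

Definition contour (n : nat) (h : C -> Y) (z p q : C) : Y :=
  minus (plus (edge n h z p) (edge n h (z + p)%C q))
        (plus (edge n h (z + q)%C p) (edge n h z q)).

Lemma edge_bound (n : nat) (h : C -> Y) (z d : C) (m : R) :
  (forall t, 0 <= t <= 1 -> norm (h (z + t * d)%C) <= m) ->
  norm (edge n h z d) <= Cmod d * m.
Proof.
  assert (Hd : forall d, (Cmod (d / 2) = Cmod d / 2)%R).
  { intros u. rewrite Cmod_div by (intros H; apply RtoC_inj in H; lra).
    rewrite Cmod_R, Rabs_right by lra. easy. }
  revert z d; induction n as [|n IH]; intros z d H; simpl.
  - eapply Rle_trans; [apply norm_scal_C|].
    apply Rmult_le_compat_l; [apply Cmod_ge_0|].
    replace (z + d / 2)%C with (z + RtoC (/ 2) * d)%C by C_eq.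
    apply H; lra.
  - eapply Rle_trans; [apply norm_triangle|].
    replace (Cmod d * m) with (Cmod (d / 2) * m + Cmod (d / 2) * m)
      by (rewrite Hd; field).
    apply Rplus_le_compat; apply IH; intros t Ht.
    + replace (z + t * (d / 2))%C with (z + RtoC (t / 2) * d)%C by C_eq.
      apply H; lra.
    + replace (z + d / 2 + t * (d / 2))%C with (z + RtoC (t / 2 + / 2) * d)%C by C_eq.
      apply H; lra.
Qed.

(** The midpoint rule is exact on affine functions. *)
Lemma edge_minus_affine (n : nat) (h : C -> Y) (c l : Y) (z d : C) :
  edge n (fun w => minus (h w) (plus c (scal (w : C_AbsRing) l))) z d =
  minus (edge n h z d)
    (plus (scal (d : C_AbsRing) c) (scal ((d * (z + d / 2))%C : C_AbsRing) l)).
Proof.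
  revert z d; induction n as [|n IH]; intros z d; simpl.
  - module_eq Y.
  - rewrite !IH. module_eq_in Y; C_eq.
Qed.

(** Each inner edge borders two quarters and is run in opposite directions, so it cancels; the outer
    edges at level [S n] are by definition pairs of half edges at level [n]. *)
Lemma contour_split (n : nat) (h : C -> Y) (z p q : C) :
  contour (S n) h z p q =
  plus (plus (contour n h z (p / 2) (q / 2)) (contour n h (z + p / 2) (p / 2) (q / 2)))
    (plus (contour n h (z + q / 2) (p / 2) (q / 2))
       (contour n h (z + p / 2 + q / 2) (p / 2) (q / 2))).
Proof.
  unfold contour; simpl.
  replace (z + p / 2 + p / 2)%C with (z + p)%C by C_eq.
  replace (z + q / 2 + q / 2)%C with (z + q)%C by C_eq.
  replace (z + q / 2 + p / 2)%C with (z + p / 2 + q / 2)%C by C_eq.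
  replace (z + p / 2 + q / 2 + p / 2)%C with (z + p + q / 2)%C by C_eq.
  replace (z + p / 2 + q / 2 + q / 2)%C with (z + q + p / 2)%C by C_eq.
  module_eq Y.
Qed.

(** The contour sum of an affine function is zero at every level, so only the deviation [m] counts,
    multiplied by the perimeter. *)
Lemma contour_affine_bound (n : nat) (h : C -> Y) (c l : Y) (z p q : C) (m : R) :
  (forall s t, 0 <= s <= 1 -> 0 <= t <= 1 ->
     norm (minus (h (z + s * p + t * q)%C)
       (plus c (scal ((z + s * p + t * q)%C : C_AbsRing) l))) <= m) ->
  norm (contour n h z p q) <= 2 * (Cmod p + Cmod q) * m.
Proof.
  intros H.
  set (r := fun w => minus (h w) (plus c (scal (w : C_AbsRing) l))).
  replace (contour n h z p q) with (contour n r z p q).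
  2: { unfold contour, r. rewrite !edge_minus_affine. module_eq_in Y; C_eq. }
  unfold contour.
  assert (Hp : forall s, 0 <= s <= 1 -> norm (r (z + s * p)%C) <= m).
  { intros s Hs. replace (z + s * p)%C with (z + s * p + 0%R * q)%C by C_eq. apply H; lra. }
  assert (Hq : forall s, 0 <= s <= 1 -> norm (r (z + s * q)%C) <= m).
  { intros s Hs. replace (z + s * q)%C with (z + 0%R * p + s * q)%C by C_eq. apply H; lra. }
  assert (Hp' : forall s, 0 <= s <= 1 -> norm (r (z + q + s * p)%C) <= m).
  { intros s Hs. replace (z + q + s * p)%C with (z + s * p + 1%R * q)%C by C_eq. apply H; lra. }
  assert (Hq' : forall s, 0 <= s <= 1 -> norm (r (z + p + s * q)%C) <= m).
  { intros s Hs. replace (z + p + s * q)%C with (z + 1%R * p + s * q)%C by C_eq. apply H; lra. }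
  apply (edge_bound n) in Hp, Hq, Hp', Hq'.
  pose proof (norm_minus_le (plus (edge n r z p) (edge n r (z + p)%C q))
    (plus (edge n r (z + q)%C p) (edge n r z q))).
  pose proof (norm_triangle (edge n r z p) (edge n r (z + p)%C q)).
  pose proof (norm_triangle (edge n r (z + q)%C p) (edge n r z q)).
  lra.
Qed.

Lemma is_derive_bound (h : C -> Y) (w : C) (l : Y) (eps : R) :
  is_derive (h : C_AbsRing -> Y) w l -> 0 < eps ->
  exists d, 0 < d /\ forall z : C, Cmod (z - w) < d ->
    norm (minus (minus (h z) (h w)) (scal ((z - w)%C : C_AbsRing) l)) <= eps * Cmod (z - w).
Proof.
  intros [_ H] Heps.
  destruct (H w (fun P HP => HP) (mkposreal eps Heps)) as [d Hd].
  exists d; split; [apply cond_pos|]. intros z Hz. exact (Hd z Hz).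
Qed.

Definition shrink (k : nat) (d : C) : C := (RtoC (/ 2 ^ k) * d)%C.

Lemma shrink_S (k : nat) (d : C) : (shrink k d / 2)%C = shrink (S k) d.
Proof.
  unfold shrink. C_eq; apply pow_nonzero; lra.
Qed.

Lemma Cmod_shrink (k : nat) (d : C) : Cmod (shrink k d) = / 2 ^ k * Cmod d.
Proof.
  unfold shrink. rewrite Cmod_mult, Cmod_R, Rabs_right; [easy|].
  apply Rle_ge, Rlt_le, Rinv_0_lt_compat, pow_lt; lra.
Qed.

Definition corner (z p q : C) (st : R * R) : C := (z + fst st * p + snd st * q)%C.

(** No convergence of the sums in [n] is known, so large means large at infinitely many levels; this
    is the negation of being eventually small. *)
Definition contour_large (h : C -> Y) (z p q : C) (eps : R) (k : nat) (st : R * R) : Prop :=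
  forall N, exists n, (N <= n)%nat /\
    eps / 4 ^ k < norm (contour n h (corner z p q st) (shrink k p) (shrink k q)).

Definition dyadic_child (k : nat) (st st' : R * R) : Prop :=
  (fst st' = fst st \/ fst st' = fst st + / 2 ^ S k) /\
  (snd st' = snd st \/ snd st' = snd st + / 2 ^ S k).

(** If all four quarters were eventually within [eps / 4 ^ S k], their sum would eventually be
    within [eps / 4 ^ k]. *)
Lemma contour_large_child (h : C -> Y) (z p q : C) (eps : R) (k : nat) (st : R * R) :
  contour_large h z p q eps k st ->
  exists st', dyadic_child k st st' /\ contour_large h z p q eps (S k) st'.
Proof.
  intros Hbad. apply NNPP; intros Hn.
  set (d := / 2 ^ S k).
  assert (Hgood : forall st', dyadic_child k st st' -> exists N, forall n, (N <= n)%nat ->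
    norm (contour n h (corner z p q st') (shrink (S k) p) (shrink (S k) q)) <= eps / 4 ^ S k).
  { intros st' Hc. apply NNPP; intros Hn'. apply Hn. exists st'; split; [easy|].
    intros N. apply NNPP; intros Hn''. apply Hn'. exists N. intros n HNn.
    apply Rnot_lt_le; intros Hlt. apply Hn''. now exists n. }
  destruct (Hgood (fst st, snd st)) as [N1 H1]; [split; simpl; tauto|].
  destruct (Hgood (fst st + d, snd st)) as [N2 H2]; [split; simpl; tauto|].
  destruct (Hgood (fst st, snd st + d)) as [N3 H3]; [split; simpl; tauto|].
  destruct (Hgood (fst st + d, snd st + d)) as [N4 H4]; [split; simpl; tauto|].
  (* The splitting consumes one level, so the predecessor of the chosen level has to pass all four
     thresholds. *)
  destruct (Hbad (S (N1 + N2 + N3 + N4))) as [[|n] [HNn Hlt]]; [lia|].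
  specialize (H1 n ltac:(lia)). specialize (H2 n ltac:(lia)).
  specialize (H3 n ltac:(lia)). specialize (H4 n ltac:(lia)).
  rewrite contour_split, !shrink_S in Hlt.
  assert (E1 : corner z p q (fst st, snd st) = corner z p q st) by (now destruct st).
  assert (E2 : corner z p q (fst st + d, snd st) = (corner z p q st + shrink (S k) p)%C).
  { unfold corner, shrink, d; cbn [fst snd]. C_eq; apply pow_nonzero; lra. }
  assert (E3 : corner z p q (fst st, snd st + d) = (corner z p q st + shrink (S k) q)%C).
  { unfold corner, shrink, d; cbn [fst snd]. C_eq; apply pow_nonzero; lra. }
  assert (E4 : corner z p q (fst st + d, snd st + d) =
    (corner z p q st + shrink (S k) p + shrink (S k) q)%C).
  { unfold corner, shrink, d; cbn [fst snd]. C_eq; apply pow_nonzero; lra. }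
  rewrite E1 in H1; rewrite E2 in H2; rewrite E3 in H3; rewrite E4 in H4.
  assert (E : eps / 4 ^ k = 4 * (eps / 4 ^ S k)).
  { simpl. field. apply pow_nonzero; lra. }
  rewrite E in Hlt.
  set (c1 := contour n h (corner z p q st) (shrink (S k) p) (shrink (S k) q)) in *.
  set (c2 := contour n h (corner z p q st + shrink (S k) p) _ _) in *.
  set (c3 := contour n h (corner z p q st + shrink (S k) q) _ _) in *.
  set (c4 := contour n h (corner z p q st + shrink (S k) p + shrink (S k) q) _ _) in *.
  pose proof (norm_triangle (plus c1 c2) (plus c3 c4)).
  pose proof (norm_triangle c1 c2). pose proof (norm_triangle c3 c4). lra.
Qed.

Lemma dyadic_nested_point (u : nat -> R) :
  u O = 0 ->
  (forall k, u (S k) = u k \/ u (S k) = u k + / 2 ^ S k) ->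
  exists v, 0 <= v <= 1 /\ forall k, u k <= v <= u k + / 2 ^ k.
Proof.
  intros H0 Hu.
  assert (Hpow : forall k, / 2 ^ k = / 2 ^ S k + / 2 ^ S k).
  { intros k. simpl. field. apply pow_nonzero; lra. }
  assert (Hpos : forall k, 0 < / 2 ^ k).
  { intros k. apply Rinv_0_lt_compat, pow_lt; lra. }
  assert (Hinc : forall k j,
    u k <= u (j + k)%nat /\ u (j + k)%nat + / 2 ^ (j + k) <= u k + / 2 ^ k).
  { intros k j; induction j as [|j IH]; [cbn [Nat.add]; lra|].
    change (S j + k)%nat with (S (j + k)).
    specialize (Hpow (j + k)%nat). pose proof (Hpos (S (j + k))).
    destruct (Hu (j + k)%nat) as [-> | ->]; lra. }
  destruct (completeness (fun r => exists k, r = u k)) as [v [Hub Hl]].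
  - exists 1. intros r [k ->]. specialize (Hinc O k). rewrite Nat.add_0_r, H0 in Hinc.
    pose proof (Hpos k). simpl (2 ^ 0) in Hinc. lra.
  - now exists (u O), O.
  - assert (Hv : forall k, u k <= v <= u k + / 2 ^ k).
    { intros k. split; [apply Hub; now exists k|].
      apply Hl. intros r [j ->].
      destruct (Nat.le_ge_cases j k) as [Hjk|Hjk].
      - specialize (Hinc j (k - j)%nat). replace (k - j + j)%nat with k in Hinc by lia.
        pose proof (Hpos k). lra.
      - specialize (Hinc k (j - k)%nat). replace (j - k + k)%nat with j in Hinc by lia.
        pose proof (Hpos j). lra. }
    exists v. split; [|easy]. specialize (Hv O). rewrite H0 in Hv. simpl in Hv. lra.
Qed.

(** Goursat's argument: if the claim fails, nested quarters with large sums close in on a point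
    where [h] has a derivative. There the distance from the tangent is a small multiple of the
    diameter; diameter and perimeter both scale like [2 ^ (-k)], which contradicts a sum above
    [eps / 4 ^ k]. *)
Lemma contour_vanishes (h : C -> Y) (z p q : C) (eps : R) :
  (forall s t, 0 <= s <= 1 -> 0 <= t <= 1 ->
     exists l, is_derive (h : C_AbsRing -> Y) (z + s * p + t * q)%C l) ->
  0 < eps ->
  exists N, forall n, (N <= n)%nat -> norm (contour n h z p q) <= eps.
Proof.
  intros Hd Heps. apply NNPP; intros Hn.
  destruct (dependent_choice (contour_large h z p q eps) dyadic_child (0, 0))
    as [u [Hu0 Hu]].
  { intros N. apply NNPP; intros Hn'. apply Hn. exists N. intros n HNn.
    apply Rnot_lt_le; intros Hlt. apply Hn'. exists n; split; [easy|].
    replace (corner z p q (0, 0)) with z by (unfold corner; simpl; C_eq).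
    replace (shrink 0 p) with p by (unfold shrink; simpl; C_eq).
    replace (shrink 0 q) with q by (unfold shrink; simpl; C_eq).
    replace (eps / 4 ^ 0) with eps by (simpl; field). easy. }
  { intros k st; apply contour_large_child. }
  destruct (dyadic_nested_point (fun k => fst (u k))) as [s [Hs Hsk]];
    [now rewrite Hu0|intros k; apply Hu|].
  destruct (dyadic_nested_point (fun k => snd (u k))) as [t [Ht Htk]];
    [now rewrite Hu0|intros k; apply Hu|].
  destruct (Hd s t Hs Ht) as [l Hl].
  set (w := (z + s * p + t * q)%C) in Hl.
  set (L := Cmod p + Cmod q + 1).
  assert (HL : 0 < L) by (unfold L; pose proof (Cmod_ge_0 p); pose proof (Cmod_ge_0 q); lra).
  (* Perimeter at most [2 * L / 2 ^ k] times deviation [eps / (2 * L * L) * (L / 2 ^ k)] is exactly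
     [eps / 4 ^ k]. The summand 1 in [L] covers degenerate rectangles. *)
  destruct (is_derive_bound h w l (eps / (2 * L * L))) as [d [Hd0 Hdl]];
    [easy|apply Rdiv_lt_0_compat; [easy|nra]|].
  destruct (pow_lt_1_zero (/ 2)) with (y := d / L) as [k Hk].
  { rewrite Rabs_right; lra. }
  { now apply Rdiv_lt_0_compat. }
  specialize (Hk k (le_n k)). rewrite Rabs_right, pow_inv in Hk
    by (apply Rle_ge, pow_le; lra).
  assert (H2k : 0 < / 2 ^ k) by (apply Rinv_0_lt_compat, pow_lt; lra).
  destruct (Hu k) as [Hlarge _]. destruct (Hlarge O) as [n [_ Hlt]].
  apply (Rlt_not_le _ _ Hlt).
  (* The constant term of the affine function tangent to [h] at [w]. *)
  set (c := minus (h w) (scal (w : C_AbsRing) l)).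
  eapply Rle_trans.
  { apply (contour_affine_bound n h c l _ _ _ (eps / (2 * L * L) * (/ 2 ^ k * L))).
    intros a b Ha Hb.
    set (x := (corner z p q (u k) + a * shrink k p + b * shrink k q)%C).
    assert (Hxw : Cmod (x - w) <= / 2 ^ k * L).
    { replace (x - w)%C with (RtoC (fst (u k) - s + a * / 2 ^ k) * p
        + RtoC (snd (u k) - t + b * / 2 ^ k) * q)%C.
      2: { unfold x, w, corner, shrink. C_eq; apply pow_nonzero; lra. }
      eapply Rle_trans; [apply Cmod_triangle|]. rewrite !Cmod_mult, !Cmod_R.
      assert (Habs : forall v v' a, v <= v' <= v + / 2 ^ k -> 0 <= a <= 1 ->
        Rabs (v - v' + a * / 2 ^ k) <= / 2 ^ k).
      { intros v v' a' Hv Ha'. apply Rabs_le. split; nra. }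
      pose proof (Rmult_le_compat_r _ _ _ (Cmod_ge_0 p) (Habs _ _ a (Hsk k) Ha)).
      pose proof (Rmult_le_compat_r _ _ _ (Cmod_ge_0 q) (Habs _ _ b (Htk k) Hb)).
      unfold L. lra. }
    apply Rle_trans with (norm (minus (minus (h x) (h w)) (scal ((x - w)%C : C_AbsRing) l))).
    { apply Req_le, f_equal. unfold c. module_eq Y. }
    eapply Rle_trans; [apply Hdl|].
    - eapply Rle_lt_trans; [exact Hxw|].
      apply (Rmult_lt_compat_r L) in Hk; [|easy].
      replace (d / L * L) with d in Hk by (field; lra). exact Hk.
    - apply Rmult_le_compat_l; [|exact Hxw].
      apply Rlt_le, Rdiv_lt_0_compat; [easy|nra]. }
  rewrite !Cmod_shrink.
  replace (eps / 4 ^ k) with (2 * (/ 2 ^ k * L) * (eps / (2 * L * L) * (/ 2 ^ k * L))).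
  2: { replace 4 with (2 * 2) by ring. rewrite Rpow_mult_distr. field.
       repeat split; try apply pow_nonzero; lra. }
  apply Rmult_le_compat_r.
  { apply Rmult_le_pos; [|nra]. apply Rlt_le, Rdiv_lt_0_compat; [easy|nra]. }
  unfold L. pose proof (Cmod_ge_0 p). pose proof (Cmod_ge_0 q). nra.
Qed.
End Goursat.

(** * The Cauchy estimate *)

Definition Cexp (w : C) : C := (exp (fst w) * cos (snd w), exp (fst w) * sin (snd w))%R.

Lemma Cexp_plus (v w : C) : Cexp (v + w) = (Cexp v * Cexp w)%C.
Proof.
  unfold Cexp. apply injective_projections; simpl; rewrite exp_plus.
  - rewrite cos_plus; ring.
  - rewrite sin_plus; ring.
Qed.

Lemma Cexp_0 : Cexp 0 = 1%C.
Proof.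
  apply injective_projections; simpl; rewrite exp_0, ?cos_0, ?sin_0; ring.
Qed.

Lemma Cexp_opp_l (w : C) : (Cexp (- w) * Cexp w)%C = 1%C.
Proof. rewrite <- Cexp_plus, <- Cexp_0. f_equal. ring. Qed.

Lemma Cmod_Cexp (w : C) : Cmod (Cexp w) = exp (fst w).
Proof.
  unfold Cmod, Cexp; simpl fst; simpl snd.
  replace ((exp (fst w) * cos (snd w)) ^ 2 + (exp (fst w) * sin (snd w)) ^ 2)%R
    with (Rsqr (exp (fst w)) * (Rsqr (sin (snd w)) + Rsqr (cos (snd w))))%R
    by (unfold Rsqr; ring).
  rewrite sin2_cos2, Rmult_1_r, sqrt_Rsqr; [easy|apply Rlt_le, exp_pos].
Qed.

Lemma Cexp_periodic (w : C) : Cexp (w + (0, 2 * PI)%R) = Cexp w.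
Proof.
  unfold Cexp; simpl. rewrite Rplus_0_r.
  now rewrite cos_plus, sin_plus, cos_2PI, sin_2PI, !Rmult_0_r, !Rmult_1_r, Rminus_0_r, Rplus_0_r.
Qed.

Lemma derivable_pt_lim_0_bound (f : R -> R) (l eps : R) :
  derivable_pt_lim f 0 l -> 0 < eps ->
  exists d, 0 < d /\ forall x, Rabs x < d -> Rabs (f x - f 0 - l * x) <= eps * Rabs x.
Proof.
  intros Hf Heps. destruct (Hf eps Heps) as [d Hd].
  exists d; split; [apply cond_pos|]. intros x Hx.
  destruct (Req_dec x 0) as [->|Hx0].
  - replace (f 0 - f 0 - l * 0)%R with 0%R by ring. rewrite Rabs_R0. lra.
  - specialize (Hd x Hx0 Hx). rewrite Rplus_0_l in Hd.
    replace (f x - f 0 - l * x)%R with (((f x - f 0) / x - l) * x)%R by (now field).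
    rewrite Rabs_mult. apply Rmult_le_compat_r; [apply Rabs_pos|lra].
Qed.

Lemma fst_le_Cmod (z : C) : Rabs (fst z) <= Cmod z.
Proof. eapply Rle_trans; [apply Rmax_l|apply Rmax_Cmod]. Qed.

Lemma snd_le_Cmod (z : C) : Rabs (snd z) <= Cmod z.
Proof. eapply Rle_trans; [apply Rmax_r|apply Rmax_Cmod]. Qed.

Lemma Cmod_le_sum (z : C) : Cmod z <= Rabs (fst z) + Rabs (snd z).
Proof.
  replace z with (RtoC (fst z) + Ci * RtoC (snd z))%C at 1
    by (destruct z; apply injective_projections; simpl; ring).
  eapply Rle_trans; [apply Cmod_triangle|].
  rewrite Cmod_mult, Cmod_Ci, !Cmod_R. lra.
Qed.

Lemma Cexp_0_bound (eps : R) :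
  0 < eps ->
  exists d, 0 < d /\ forall k : C, Cmod k < d -> Cmod (Cexp k - 1 - k) <= eps * Cmod k.
Proof.
  intros Heps.
  (* The real and the imaginary part of the error will each be at most [3 * e * m]; the cap 1 keeps
     [exp x] below 2. *)
  set (e := Rmin (eps / 10) 1).
  assert (He : 0 < e) by (apply Rmin_glb_lt; lra).
  assert (He1 : e <= eps / 10) by apply Rmin_l.
  assert (He2 : e <= 1) by apply Rmin_r.
  destruct (derivable_pt_lim_0_bound exp (exp 0) e) as [d1 [Hd1 H1]];
    [apply derivable_pt_lim_exp|easy|].
  destruct (derivable_pt_lim_0_bound cos (- sin 0) e) as [d2 [Hd2 H2]];
    [apply derivable_pt_lim_cos|easy|].
  destruct (derivable_pt_lim_0_bound sin (cos 0) e) as [d3 [Hd3 H3]];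
    [apply derivable_pt_lim_sin|easy|].
  rewrite exp_0 in H1. rewrite sin_0, cos_0 in H2. rewrite sin_0, cos_0 in H3.
  exists (Rmin (Rmin d1 d2) (Rmin d3 (e / 2))). split.
  { repeat apply Rmin_glb_lt; lra. }
  intros k Hk.
  apply Rmin_Rgt_l in Hk. destruct Hk as [Hk1 Hk2].
  apply Rmin_Rgt_l in Hk1. apply Rmin_Rgt_l in Hk2.
  pose proof (fst_le_Cmod k) as Hx. pose proof (snd_le_Cmod k) as Hy.
  eapply Rle_trans; [apply Cmod_le_sum|].
  unfold Cexp; simpl.
  set (x := fst k) in *. set (y := snd k) in *. set (m := Cmod k) in *.
  specialize (H1 x ltac:(lra)). specialize (H2 y ltac:(lra)). specialize (H3 y ltac:(lra)).
  pose proof (Rabs_pos x) as Px. pose proof (Rabs_pos y) as Py.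
  assert (Hex : Rabs (exp x - 1) <= e).
  { replace (exp x - 1)%R with ((exp x - 1 - 1 * x) + x)%R by ring.
    eapply Rle_trans; [apply Rabs_triang|]. nra. }
  assert (Hex2 : Rabs (exp x) <= 2).
  { replace (exp x) with ((exp x - 1) + 1)%R by ring.
    eapply Rle_trans; [apply Rabs_triang|]. rewrite Rabs_R1. lra. }
  assert (HRe : Rabs (exp x * cos y + - (1) + - x) <= 3 * e * m).
  { replace (exp x * cos y + - (1) + - x)%R
      with ((exp x - 1 - 1 * x) + exp x * (cos y - 1 - - 0 * y))%R by ring.
    eapply Rle_trans; [apply Rabs_triang|]. rewrite Rabs_mult.
    pose proof (Rabs_pos (cos y - 1 - - 0 * y)). pose proof (Rabs_pos (exp x)). nra. }
  assert (HIm : Rabs (exp x * sin y + - 0 + - y) <= 3 * e * m).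
  { replace (exp x * sin y + - 0 + - y)%R
      with (exp x * (sin y - 0 - 1 * y) + (exp x - 1) * y)%R by ring.
    eapply Rle_trans; [apply Rabs_triang|]. rewrite !Rabs_mult.
    pose proof (Rabs_pos (sin y - 0 - 1 * y)). pose proof (Rabs_pos (exp x)).
    pose proof (Rabs_pos (exp x - 1)). nra. }
  assert (0 <= m) by apply Cmod_ge_0. nra.
Qed.

Lemma is_derive_Cexp (w : C) :
  is_derive (Cexp : C_AbsRing -> AbsRing_NormedModule C_AbsRing) w (Cexp w).
Proof.
  split; [apply is_linear_scal_l|].
  intros w' Hw'.
  apply (is_filter_lim_locally_unique (V := AbsRing_NormedModule C_AbsRing)) in Hw'.
  subst w'. intros eps.
  pose proof (exp_pos (fst w)) as Hexp.
  destruct (Cexp_0_bound (eps / exp (fst w))) as [d [Hd H]].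
  { apply Rdiv_lt_0_compat; [apply cond_pos|easy]. }
  exists (mkposreal d Hd). intros z Hz.
  change (Cmod (Cexp z - Cexp w - (z - w) * Cexp w) <= eps * Cmod (z - w)).
  change (Cmod (z - w) < d) in Hz.
  replace (Cexp z) with (Cexp w * Cexp (z - w))%C
    by (rewrite <- Cexp_plus; f_equal; ring).
  replace (Cexp w * Cexp (z - w) - Cexp w - (z - w) * Cexp w)%C
    with (Cexp w * (Cexp (z - w) - 1 - (z - w)))%C by ring.
  rewrite Cmod_mult, Cmod_Cexp.
  apply (Rmult_le_reg_l (/ exp (fst w))); [now apply Rinv_0_lt_compat|].
  rewrite <- Rmult_assoc, Rinv_l, Rmult_1_l by lra.
  specialize (H _ Hz). unfold Rdiv in H. lra.
Qed.

Section CauchyEstimate.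
Context {Y : NormedModule C_AbsRing}.

(** Needed for [v] a period of the integrand, where it identifies two opposite edges of a
    rectangle. *)
Lemma edge_ext (n : nat) (h k : C -> Y) (z v d : C) :
  (forall w, h w = k (w + v)%C) -> edge n h z d = edge n k (z + v)%C d.
Proof.
  intros H. revert z d; induction n as [|n IH]; intros z d; simpl.
  - rewrite H. do 2 f_equal. ring.
  - rewrite !IH. do 2 f_equal. ring.
Qed.

(** Sub-homogeneity applied to the scalar [/ k] gives the reverse inequality. *)
Lemma norm_le_scal (k : C) (y : Y) : Cmod k * norm y <= norm (scal (k : C_AbsRing) y).
Proof.
  destruct (Req_dec (Cmod k) 0) as [H0|H0].
  { rewrite H0, Rmult_0_l. apply norm_ge_0. }
  assert (Hk : k <> 0%C) by (intros ->; apply H0, Cmod_0).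
  assert (E : y = scal ((/ k)%C : C_AbsRing) (scal (k : C_AbsRing) y)) by (module_eq Y; easy).
  rewrite E at 1. pose proof (norm_scal_C (/ k)%C (scal (k : C_AbsRing) y)) as H.
  rewrite Cmod_inv in H by easy.
  pose proof (Cmod_ge_0 k).
  apply (Rmult_le_compat_l (Cmod k)) in H; [|easy].
  rewrite <- Rmult_assoc, Rinv_r, Rmult_1_l in H by easy. exact H.
Qed.

(** The function [h] below is the integrand of [(phi z - phi 0) / z^2 dz] after the substitution
    [z = e^w]. It has period [2 pi i], so on a rectangle of that height the horizontal edges cancel,
    and the vertical ones are integrals over two circles around 0. The outer one is at most
    [2 pi * 2 M / rho]; the inner one is close to [2 pi i l]. Subtracting [phi 0] costs the factor 2
    and keeps the integrand bounded near 0, where it tends to [l]. *)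
Lemma cauchy_derivative_bound (phi : C -> Y) (rho M : R) (l : Y) :
  0 < rho ->
  (forall z, Cmod z <= rho -> ex_derive (phi : C_AbsRing -> Y) z) ->
  (forall z, Cmod z <= rho -> norm (phi z) <= M) ->
  is_derive (phi : C_AbsRing -> Y) (0 : C) l ->
  norm l <= 2 * M / rho.
Proof.
  intros Hrho Hdiff HM Hl. apply le_epsilon. intros eps Heps.
  destruct (is_derive_bound phi 0 l (eps / 2) Hl) as [d [Hd Hdl]]; [lra|].
  set (h := fun w : C => scal (Cexp (- w) : C_AbsRing) (minus (phi (Cexp w)) (phi 0%C))).
  (* Logarithms of the outer and the inner radius; the inner circle lies where the linear
     approximation of [phi] at 0 has error at most [eps / 2] per unit. *)
  set (s1 := ln rho). set (s0 := ln (Rmin rho (d / 2))).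
  set (q := (0, 2 * PI)%R : C).
  assert (Hmin : 0 < Rmin rho (d / 2)) by (apply Rmin_glb_lt; lra).
  assert (Hs : s0 <= s1) by (apply ln_le; [easy|apply Rmin_l]).
  assert (Hq : Cmod q = 2 * PI).
  { unfold Cmod, q; simpl. rewrite !Rmult_1_r, Rmult_0_l, Rplus_0_l.
    apply sqrt_square. pose proof PI_RGT_0; lra. }
  assert (Hh : forall w : C, fst w <= s1 -> ex_derive (h : C_AbsRing -> Y) w).
  { intros w Hw.
    destruct (Hdiff (Cexp w)) as [l' Hl'].
    { rewrite Cmod_Cexp. replace rho with (exp s1) by now apply exp_ln.
      destruct (Req_dec (fst w) s1) as [->|]; [lra|]. apply Rlt_le, exp_increasing; lra. }
    apply ex_derive_filterdiff.
    eexists.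
    apply (filterdiff_scal_fct (K := C_AbsRing) (U := AbsRing_NormedModule C_AbsRing) (V := Y)
      w (fun w => Cexp (- w)) (fun w => minus (phi (Cexp w)) (phi 0%C))); [exact Cmult_comm| |].
    - apply (is_derive_comp (K := C_AbsRing) (V := AbsRing_NormedModule C_AbsRing)
        Cexp (fun w : C_AbsRing => opp w)).
      + apply is_derive_Cexp.
      + apply (is_derive_opp (K := C_AbsRing) (V := AbsRing_NormedModule C_AbsRing) (fun w => w)).
        apply is_derive_id.
    - eapply (filterdiff_minus_fct (K := C_AbsRing) (U := AbsRing_NormedModule C_AbsRing)
        (V := Y)); [|apply filterdiff_const].
      apply (is_derive_comp (phi : C_AbsRing -> Y) (Cexp : C_AbsRing -> C_AbsRing) w l');
        [exact Hl'|apply is_derive_Cexp]. }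
  (* The error [PI * eps] of the contour and the error [2 * PI * (eps / 2)] on the inner circle add
     up to [2 * PI * eps], which is [eps] after division by [2 * PI]. *)
  destruct (contour_vanishes h (RtoC s0) (RtoC (s1 - s0)) q (PI * eps)) as [n Hn].
  { intros s t Hs' Ht. apply Hh. simpl. nra. }
  { apply Rmult_lt_0_compat; [apply PI_RGT_0|easy]. }
  specialize (Hn n (le_n n)). unfold contour in Hn.
  rewrite (edge_ext n h h (RtoC s0) q (RtoC (s1 - s0))) in Hn.
  2: { intros w. unfold h, q.
       replace (Cexp (- w)) with (Cexp (- (w + (0, 2 * PI)%R))).
       - now rewrite Cexp_periodic.
       - rewrite <- Cexp_periodic. f_equal. ring. }
  replace (RtoC s0 + RtoC (s1 - s0))%C with (RtoC s1) in Hn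
    by (apply injective_projections; simpl; ring).
  set (E := edge n h (RtoC s0 + q)%C (RtoC (s1 - s0))) in Hn.
  set (Er := edge n h (RtoC s1) q) in Hn. set (El := edge n h (RtoC s0) q) in Hn.
  assert (Hn' : norm (minus El Er) <= PI * eps).
  { eapply Rle_trans; [|apply Hn]. rewrite norm_minus_sym. apply Req_le. f_equal. module_eq Y. }
  assert (HEr : norm Er <= 2 * PI * (2 * M / rho)).
  { unfold Er. rewrite <- Hq. apply edge_bound. intros t Ht. unfold h.
    eapply Rle_trans; [apply norm_scal_C|].
    rewrite Cmod_Cexp.
    replace (fst (- (RtoC s1 + t * q))%C) with (- s1)%R by (simpl; ring).
    rewrite exp_Ropp. unfold s1 at 1. rewrite exp_ln by easy.
    unfold Rdiv. rewrite Rmult_comm. apply Rmult_le_compat_r.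
    { now apply Rlt_le, Rinv_0_lt_compat. }
    eapply Rle_trans; [apply norm_minus_le|].
    assert (norm (phi (Cexp (RtoC s1 + t * q))) <= M).
    { apply HM. rewrite Cmod_Cexp. simpl.
      replace (s1 + (t * 0 - 0 * (2 * PI)))%R with s1 by ring.
      apply Req_le. now apply exp_ln. }
    assert (norm (phi 0%C) <= M) by (apply HM; rewrite Cmod_0; lra). lra. }
  (* The midpoint sum of the constant [l] is exact, so a pointwise comparison of [h] with [l]
     suffices; in it the moduli of [Cexp (- w)] and [Cexp w] cancel. *)
  assert (HEl : norm (minus El (scal (q : C_AbsRing) l)) <= 2 * PI * (eps / 2)).
  { apply Rle_trans with (norm (edge n (fun w => minus (h w)
      (plus l (scal (w : C_AbsRing) zero))) (RtoC s0) q)).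
    { apply Req_le, f_equal. etransitivity; [|symmetry; apply edge_minus_affine].
      fold El. module_eq Y. }
    rewrite <- Hq. apply edge_bound. intros t Ht.
    set (w := (RtoC s0 + t * q)%C).
    assert (Hw : Cmod (Cexp w) = Rmin rho (d / 2)).
    { rewrite Cmod_Cexp. unfold w; simpl.
      replace (s0 + (t * 0 - 0 * (2 * PI)))%R with s0 by ring. now apply exp_ln. }
    apply Rle_trans with (norm (scal (Cexp (- w) : C_AbsRing)
      (minus (minus (phi (Cexp w)) (phi 0%C)) (scal ((Cexp w - 0)%C : C_AbsRing) l)))).
    { apply Req_le, f_equal. unfold h. module_eq_in Y; try ring.
      transitivity (- (1))%C; [ring|]. rewrite <- (Cexp_opp_l w) at 1. ring. }
    eapply Rle_trans; [apply norm_scal_C|].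
    assert (Hd' : Cmod (Cexp w - 0) = Rmin rho (d / 2)).
    { replace (Cexp w - 0)%C with (Cexp w) by ring. exact Hw. }
    eapply Rle_trans; [apply Rmult_le_compat_l; [apply Cmod_ge_0|apply Hdl]|].
    { rewrite Hd'. pose proof (Rmin_r rho (d / 2)). lra. }
    rewrite Hd', <- Hw.
    replace (Cmod (Cexp (- w)) * (eps / 2 * Cmod (Cexp w)))%R
      with (eps / 2 * Cmod (Cexp (- w) * Cexp w))%R by (rewrite Cmod_mult; ring).
    rewrite Cexp_opp_l, Cmod_1. lra. }
  pose proof (norm_le_scal q l) as Hql. rewrite Hq in Hql.
  pose proof (norm_le_minus (scal (q : C_AbsRing) l) El) as H1.
  rewrite norm_minus_sym in H1. pose proof (norm_le_minus El Er) as H2.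
  pose proof PI_RGT_0 as HPI.
  apply (Rmult_le_reg_l (2 * PI)); [lra|]. lra.
Qed.
End CauchyEstimate.

(** * Holomorphic maps of Banach spaces *)

Lemma Rle_of_all_inv (a b K : R) :
  (forall n : nat, a <= b + K * / INR (S n)) -> a <= b.
Proof.
  intros H. apply le_epsilon. intros eps Heps.
  assert (HK : 0 < Rabs K + 1) by (pose proof (Rabs_pos K); lra).
  destruct (archimed_cor1 (eps / (Rabs K + 1))) as [[|n] [Hn Hn0]];
    [now apply Rdiv_lt_0_compat|lia|].
  specialize (H n). pose proof (Rle_abs K).
  assert (Hpos : 0 < / INR (S n)) by (apply Rinv_0_lt_compat, lt_0_INR; lia).
  apply (Rmult_lt_compat_r (Rabs K + 1)) in Hn; [|easy].
  unfold Rdiv in Hn. rewrite (Rmult_assoc eps), Rinv_l, Rmult_1_r in Hn by lra. nra.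
Qed.

Section Lipschitz.
Context {X Y : NormedModule C_AbsRing}.

Lemma locally_ball_norm (x : X) (P : X -> Prop) :
  locally x P -> exists d, 0 < d /\ forall y, norm (minus y x) < d -> P y.
Proof.
  intros H. apply locally_norm_le_locally in H. destruct H as [d Hd].
  exists d; split; [apply cond_pos|exact Hd].
Qed.

Lemma ball_norm_locally (x : X) (P : X -> Prop) (d : R) :
  0 < d -> (forall y, norm (minus y x) < d -> P y) -> locally x P.
Proof.
  intros Hd H. apply locally_le_locally_norm. exists (mkposreal d Hd). exact H.
Qed.

Lemma ex_filterdiff_continuous (f : X -> Y) (x : X) (eps : R) :
  ex_filterdiff f (locally x) -> 0 < eps ->
  exists d, 0 < d /\ forall y, norm (minus y x) < d -> norm (minus (f y) (f x)) < eps.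
Proof.
  intros Hf Heps. apply filterdiff_continuous in Hf.
  apply locally_ball_norm.
  exact (proj1 (filterlim_locally_ball_norm f (f x)) Hf (mkposreal eps Heps)).
Qed.

Lemma filterdiff_bound (f l : X -> Y) (x : X) (eps : R) :
  filterdiff f (locally x) l -> 0 < eps ->
  exists d, 0 < d /\ forall y, norm (minus y x) < d ->
    norm (minus (minus (f y) (f x)) (l (minus y x))) <= eps * norm (minus y x).
Proof.
  intros [_ H] Heps. apply locally_ball_norm.
  exact (H x (fun P HP => HP) (mkposreal eps Heps)).
Qed.

Lemma filterdiff_of_bound (f l : X -> Y) (x : X) :
  is_linear l ->
  (forall eps, 0 < eps -> exists d, 0 < d /\ forall y, norm (minus y x) < d ->
     norm (minus (minus (f y) (f x)) (l (minus y x))) <= eps * norm (minus y x)) ->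
  filterdiff f (locally x) l.
Proof.
  intros Hl H. split; [easy|]. intros x' Hx'.
  apply is_filter_lim_locally_unique in Hx'. subst x'. intros [eps Heps].
  destruct (H eps Heps) as [d [Hd Hd']]. now apply (ball_norm_locally x _ d).
Qed.

Lemma is_derive_along_line (g l : X -> Y) (x u : X) (k : C) :
  filterdiff g (locally (plus x (scal (k : C_AbsRing) u))) l ->
  is_derive (fun k : C_AbsRing => g (plus x (scal k u))) k (l u).
Proof.
  intros Hg. unfold is_derive.
  eapply filterdiff_ext_lin.
  - apply (filterdiff_comp' (fun k : C_AbsRing => plus x (scal k u)) g k
      (fun k : C_AbsRing => plus zero (scal k u)) l); [|exact Hg].
    apply filterdiff_plus_fct; [apply filterdiff_const|].
    apply filterdiff_linear, is_linear_scal_l.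
  - intros y. simpl. rewrite plus_zero_l. apply linear_scal. apply Hg.
Qed.

(** The one-variable estimate is applied to [z -> g (x + z u)] on the disc of radius [r / (4 |u|)],
    whose image stays within [3 r / 4] of [x0]; [2 M] divided by this radius gives the constant
    8. *)
Lemma derivative_bound (g l : X -> Y) (x0 x u : X) (r M : R) :
  0 < r ->
  (forall y, norm (minus y x0) < r -> ex_filterdiff g (locally y)) ->
  (forall y, norm (minus y x0) < r -> norm (g y) <= M) ->
  norm (minus x x0) < r / 2 ->
  filterdiff g (locally x) l ->
  norm (l u) <= 8 * M / r * norm u.
Proof.
  intros Hr Hg HM Hx Hl.
  destruct (Req_dec (norm u) 0) as [Hu|Hu].
  { apply norm_eq_zero in Hu. subst u. rewrite linear_zero by apply Hl.
    rewrite !norm_zero. lra. }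
  assert (Hu' : 0 < norm u) by (pose proof (norm_ge_0 u); lra).
  assert (Hin : forall z : C, Cmod z <= r / (4 * norm u) ->
    norm (minus (plus x (scal (z : C_AbsRing) u)) x0) < r).
  { intros z Hz.
    replace (minus (plus x (scal (z : C_AbsRing) u)) x0)
      with (plus (minus x x0) (scal (z : C_AbsRing) u)) by module_eq X.
    eapply Rle_lt_trans; [apply norm_triangle|].
    pose proof (norm_scal_C z u).
    apply (Rmult_le_compat_r (norm u)) in Hz; [|lra].
    replace (r / (4 * norm u) * norm u) with (r / 4) in Hz by (field; lra). lra. }
  assert (E0 : plus x (scal ((0 : C) : C_AbsRing) u) = x) by module_eq X.
  replace (8 * M / r * norm u) with (2 * M / (r / (4 * norm u))) by (field; lra).
  apply (cauchy_derivative_bound (fun z : C => g (plus x (scal (z : C_AbsRing) u)))).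
  - apply Rdiv_lt_0_compat; lra.
  - intros z Hz. destruct (Hg _ (Hin z Hz)) as [l' Hl'].
    exists (l' u). now apply is_derive_along_line.
  - intros z Hz. now apply HM, Hin.
  - apply is_derive_along_line. now rewrite E0.
Qed.

Lemma norm_scal_R (t : R) (u : X) : norm (scal (RtoC t : C_AbsRing) u) <= Rabs t * norm u.
Proof. rewrite <- Cmod_R. apply norm_scal_C. Qed.

(** The derivative bound is integrated along the segment from [x] to [y], which stays in the half
    ball by convexity, using real induction. *)
Lemma lipschitz_of_bounded (g : X -> Y) (x0 x y : X) (r M : R) :
  0 < r ->
  (forall z, norm (minus z x0) < r -> ex_filterdiff g (locally z)) ->
  (forall z, norm (minus z x0) < r -> norm (g z) <= M) ->
  norm (minus x x0) < r / 2 -> norm (minus y x0) < r / 2 ->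
  norm (minus (g y) (g x)) <= 8 * M / r * norm (minus y x).
Proof.
  intros Hr Hg HM Hx Hy. apply le_epsilon. intros eps Heps.
  (* The extra [eps] in the slope absorbs the differentiability remainder at each step of the
     induction. *)
  set (u := minus y x). set (K := 8 * M / r * norm u + eps).
  set (pt := fun t : R => plus x (scal (RtoC t : C_AbsRing) u)).
  assert (Hpt : forall t, 0 <= t <= 1 -> norm (minus (pt t) x0) < r / 2).
  { intros t Ht.
    replace (minus (pt t) x0) with (plus (scal (RtoC (1 - t) : C_AbsRing) (minus x x0))
      (scal (RtoC t : C_AbsRing) (minus y x0))).
    2: { unfold pt, u. module_eq_in X; C_eq. }
    eapply Rle_lt_trans; [apply norm_triangle|].
    pose proof (norm_scal_R (1 - t) (minus x x0)) as H1.
    pose proof (norm_scal_R t (minus y x0)) as H2.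
    rewrite Rabs_right in H1 by lra. rewrite Rabs_right in H2 by lra.
    set (m := Rmax (norm (minus x x0)) (norm (minus y x0))).
    assert (m < r / 2) by now apply Rmax_lub_lt.
    pose proof (Rmax_l (norm (minus x x0)) (norm (minus y x0))) as Hm1.
    pose proof (Rmax_r (norm (minus x x0)) (norm (minus y x0))) as Hm2. fold m in Hm1, Hm2.
    apply (Rmult_le_compat_l (1 - t)) in Hm1; [|lra].
    apply (Rmult_le_compat_l t) in Hm2; lra. }
  assert (Hstep : forall t, 0 <= t <= 1 -> exists d, 0 < d /\ forall h, Rabs h < d ->
    norm (minus (g (pt (t + h))) (g (pt t))) <= Rabs h * K).
  { intros t Ht. specialize (Hpt t Ht).
    destruct (Hg (pt t)) as [l Hl]; [lra|].
    pose proof (norm_ge_0 u) as Hu.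
    destruct (filterdiff_bound g l (pt t) (eps / (norm u + 1)) Hl) as [d [Hd Hd']].
    { apply Rdiv_lt_0_compat; lra. }
    exists (d / (norm u + 1)). split; [apply Rdiv_lt_0_compat; lra|]. intros h Hh.
    assert (E : minus (pt (t + h)) (pt t) = scal (RtoC h : C_AbsRing) u).
    { unfold pt. module_eq_in X; C_eq. }
    specialize (Hd' (pt (t + h))). rewrite E in Hd'.
    pose proof (norm_scal_R h u) as Hhu. pose proof (Rabs_pos h) as Hh0.
    apply (Rmult_lt_compat_r (norm u + 1)) in Hh; [|lra].
    replace (d / (norm u + 1) * (norm u + 1)) with d in Hh by (field; lra).
    specialize (Hd' ltac:(nra)).
    pose proof (derivative_bound g l x0 (pt t) (scal (RtoC h : C_AbsRing) u) r M
      Hr Hg HM Hpt Hl) as Hb.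
    pose proof (norm_le_minus (minus (g (pt (t + h))) (g (pt t)))
      (l (scal (RtoC h : C_AbsRing) u))) as Hn.
    assert (HM0 : 0 <= 8 * M / r).
    { apply Rmult_le_pos; [|now apply Rlt_le, Rinv_0_lt_compat].
      pose proof (norm_ge_0 (g (pt t))). specialize (HM (pt t) ltac:(lra)). lra. }
    assert (H1 : eps / (norm u + 1) * norm (scal (RtoC h : C_AbsRing) u) <= Rabs h * eps).
    { apply Rle_trans with (eps / (norm u + 1) * (Rabs h * (norm u + 1))).
      - apply Rmult_le_compat_l; [apply Rlt_le, Rdiv_lt_0_compat; lra|nra].
      - apply Req_le. field. lra. }
    assert (H2 : 8 * M / r * norm (scal (RtoC h : C_AbsRing) u)
      <= 8 * M / r * (Rabs h * norm u)) by now apply Rmult_le_compat_l.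
    unfold K. lra. }
  assert (H : forall t, 0 <= t <= 1 -> norm (minus (g (pt t)) (g (pt 0))) <= t * K).
  { apply real_induction.
    - rewrite Rmult_0_l. replace (minus (g (pt 0)) (g (pt 0))) with (zero : Y) by module_eq Y.
      rewrite norm_zero. lra.
    - intros t Ht IH. destruct (Hstep t) as [d [Hd H]]; [lra|]. exists d; split; [easy|].
      intros h Hh. specialize (H h). rewrite Rabs_right in H by lra. specialize (H ltac:(lra)).
      specialize (IH t ltac:(lra)).
      pose proof (norm_minus_triangle (g (pt (t + h))) (g (pt t)) (g (pt 0))). lra.
    - intros t Ht IH. destruct (Hstep t) as [d [Hd H]]; [lra|].
      set (h := Rmin (d / 2) t).
      assert (0 < h) by (apply Rmin_glb_lt; lra).
      assert (h <= d / 2) by apply Rmin_l. assert (h <= t) by apply Rmin_r.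
      specialize (H (- h)). rewrite Rabs_Ropp, Rabs_right in H by lra.
      specialize (H ltac:(lra)). specialize (IH (t + - h) ltac:(lra)).
      rewrite norm_minus_sym in H.
      pose proof (norm_minus_triangle (g (pt t)) (g (pt (t + - h))) (g (pt 0))). lra. }
  specialize (H 1 ltac:(lra)).
  replace (pt 1) with y in H by (unfold pt, u; module_eq_in X; C_eq).
  replace (pt 0) with x in H by (unfold pt, u; module_eq_in X; C_eq).
  rewrite Rmult_1_l in H. exact H.
Qed.
End Lipschitz.

Definition norm_complete (Y : NormedModule C_AbsRing) : Prop :=
  forall f : nat -> Y,
    (forall eps, 0 < eps -> exists N, forall n m, (N <= n)%nat -> (N <= m)%nat ->
       norm (minus (f m) (f n)) < eps) ->
    exists y, forall eps, 0 < eps -> exists N, forall n, (N <= n)%nat ->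
      norm (minus (f n) y) < eps.

Lemma banach_norm_complete (Y : BanachSpace) : norm_complete Y.
Proof.
  intros f H.
  destruct (proj1 (filterlim_locally_cauchy (F := eventually) f)) as [y Hy].
  { intros eps. destruct (H eps (cond_pos eps)) as [N HN].
    exists (fun n => (N <= n)%nat). split; [now exists N|]. intros n m Hn Hm.
    apply (norm_compat1 (V := Y)). now apply HN. }
  exists y. intros eps Heps.
  exact (proj1 (filterlim_locally_ball_norm (U := Y) f y) Hy (mkposreal eps Heps)).
Qed.

(** * Holomorphy of locally uniform limits *)

Section UniformLimit.
Context {X Y : NormedModule C_AbsRing}.

(** The Cauchy estimates are applied to differences of approximants: the derivatives at [x0] then
    form a Cauchy sequence, whose limit [L] is linear and bounded, and the increments of the
    differences carry a factor [|x - x0|], so the remainder of [f] is controlled by that of one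
    fixed [g n]. *)
Lemma ex_filterdiff_uniform_limit (f : X -> Y) (x0 : X) (r : R) :
  norm_complete Y ->
  0 < r ->
  (forall eps, 0 < eps -> exists g : X -> Y,
     (forall x, norm (minus x x0) < r -> ex_filterdiff g (locally x)) /\
     (forall x, norm (minus x x0) < r -> norm (minus (g x) (f x)) <= eps)) ->
  ex_filterdiff f (locally x0).
Proof.
  intros Hcomplete Hr Happ.
  set (e := fun n : nat => / INR (S n)).
  assert (He : forall n, 0 < e n) by (intros n; apply Rinv_0_lt_compat, lt_0_INR; lia).
  assert (Hdec : forall n m, (n <= m)%nat -> e m <= e n).
  { intros n m Hnm. apply Rinv_le_contravar; [apply lt_0_INR; lia|apply le_INR; lia]. }
  assert (Hx0 : norm (minus x0 x0) < r / 2).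
  { replace (minus x0 x0) with (zero : X) by module_eq X. rewrite norm_zero. lra. }
  assert (Happ' : forall n, exists gl : (X -> Y) * (X -> Y),
    (forall x, norm (minus x x0) < r -> ex_filterdiff (fst gl) (locally x)) /\
    (forall x, norm (minus x x0) < r -> norm (minus (fst gl x) (f x)) <= e n) /\
    filterdiff (fst gl) (locally x0) (snd gl)).
  { intros n. destruct (Happ (e n) (He n)) as [g [Hg1 Hg2]].
    destruct (Hg1 x0) as [l Hl]; [lra|]. now exists (g, l). }
  set (gl := fun n => proj1_sig (constructive_indefinite_description _ (Happ' n))).
  set (g := fun n => fst (gl n)). set (l := fun n => snd (gl n)).
  assert (Hg1 : forall n x, norm (minus x x0) < r -> ex_filterdiff (g n) (locally x)).
  { intros n. exact (proj1 (proj2_sig (constructive_indefinite_description _ (Happ' n)))). }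
  assert (Hg2 : forall n x, norm (minus x x0) < r -> norm (minus (g n x) (f x)) <= e n).
  { intros n. exact (proj1 (proj2 (proj2_sig (constructive_indefinite_description _ (Happ' n))))). }
  assert (Hl : forall n, filterdiff (g n) (locally x0) (l n)).
  { intros n. exact (proj2 (proj2 (proj2_sig (constructive_indefinite_description _ (Happ' n))))). }
  clearbody g l. clear gl Happ' Happ.
  (* [K * e n] is the Lipschitz constant [8 * (2 * e n) / r] of a difference of approximants from
     index [n] on. *)
  set (K := 16 / r).
  assert (HK : 0 < K) by (apply Rdiv_lt_0_compat; lra).
  assert (Hdiff : forall n m x, (n <= m)%nat -> norm (minus x x0) < r ->
    norm (minus (g m x) (g n x)) <= 2 * e n).
  { intros n m x Hnm Hx. pose proof (Hg2 n x Hx) as H1. rewrite norm_minus_sym in H1.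
    pose proof (Hg2 m x Hx). specialize (Hdec n m Hnm).
    pose proof (norm_minus_triangle (g m x) (f x) (g n x)). lra. }
  assert (Hex : forall n m x, norm (minus x x0) < r ->
    ex_filterdiff (fun x => minus (g m x) (g n x)) (locally x)).
  { intros n m x Hx. destruct (Hg1 n x Hx) as [l1 H1]. destruct (Hg1 m x Hx) as [l2 H2].
    eexists. apply (filterdiff_minus_fct (g m) (g n)); eassumption. }
  assert (Hlip : forall n m x, (n <= m)%nat -> norm (minus x x0) < r / 2 ->
    norm (minus (minus (g m x) (g n x)) (minus (g m x0) (g n x0)))
      <= K * norm (minus x x0) * e n).
  { intros n m x Hnm Hx.
    eapply Rle_trans.
    - apply (lipschitz_of_bounded (fun x => minus (g m x) (g n x)) x0 x0 x r (2 * e n));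
        try easy; auto.
    - apply Req_le. unfold K. field. lra. }
  assert (Hlnm : forall n m u, (n <= m)%nat ->
    norm (minus (l m u) (l n u)) <= K * norm u * e n).
  { intros n m u Hnm.
    eapply Rle_trans.
    - apply (derivative_bound (fun x => minus (g m x) (g n x))
        (fun u => minus (l m u) (l n u)) x0 x0 u r (2 * e n)); try easy; auto.
      apply (filterdiff_minus_fct (g m) (g n)); apply Hl.
    - apply Req_le. unfold K. field. lra. }
  assert (Hlim : forall u, exists v, forall eps, 0 < eps ->
    exists N, forall n, (N <= n)%nat -> norm (minus (l n u) v) < eps).
  { intros u. apply Hcomplete. intros eps Heps.
    assert (HKu : 0 < 2 * (K * norm u + 1)).
    { pose proof (norm_ge_0 u). nra. }
    destruct (archimed_cor1 (eps / (2 * (K * norm u + 1)))) as [[|N] [HN HN0]];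
      [now apply Rdiv_lt_0_compat|lia|].
    exists N. intros n m Hn Hm.
    pose proof (Hlnm N n u Hn) as H1. pose proof (Hlnm N m u Hm) as H2.
    rewrite norm_minus_sym in H1.
    pose proof (norm_minus_triangle (l m u) (l N u) (l n u)).
    pose proof (He N) as HeN. fold (e N) in HN.
    apply (Rmult_lt_compat_r (2 * (K * norm u + 1))) in HN; [|easy].
    unfold Rdiv in HN. rewrite (Rmult_assoc eps), Rinv_l, Rmult_1_r in HN by lra.
    lra. }
  set (L := fun u => proj1_sig (constructive_indefinite_description _ (Hlim u))).
  assert (HL : forall n u, norm (minus (L u) (l n u)) <= K * norm u * e n).
  { intros n u. apply le_epsilon. intros eps Heps.
    pose proof (proj2_sig (constructive_indefinite_description _ (Hlim u)) eps Heps) as [N HN].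
    fold (L u) in HN. specialize (HN (Nat.max n N) (Nat.le_max_r _ _)).
    pose proof (Hlnm n (Nat.max n N) u (Nat.le_max_l _ _)).
    rewrite norm_minus_sym in HN.
    pose proof (norm_minus_triangle (L u) (l (Nat.max n N) u) (l n u)). lra. }
  clearbody L. clear Hlim.
  assert (Hlin : forall n, is_linear (l n)) by (intros n; apply Hl).
  assert (Heq : forall a b : Y, (exists K', forall n, norm (minus a b) <= K' * e n) -> a = b).
  { intros a b [K' H]. replace a with (plus (minus a b) b) by module_eq Y.
    rewrite (norm_eq_zero (minus a b)); [apply plus_zero_l|].
    apply Rle_antisym; [|apply norm_ge_0].
    apply (Rle_of_all_inv _ _ K'). intros n. rewrite Rplus_0_l. apply H. }
  exists L. apply filterdiff_of_bound.
  - split.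
    + assert (HLp : forall u v, L (plus u v) = plus (L u) (L v)); [|exact HLp].
      intros u v. apply Heq. exists (K * norm (plus u v) + K * norm u + K * norm v). intros n.
      pose proof (HL n (plus u v)) as H1. pose proof (HL n u) as H2. pose proof (HL n v) as H3.
      assert (El : l n (plus u v) = plus (l n u) (l n v)) by apply (linear_plus (l n) (Hlin n)).
      rewrite El in H1.
      pose proof (norm_minus_triangle (L (plus u v)) (plus (l n u) (l n v)) (plus (L u) (L v))).
      rewrite norm_minus_sym in H2, H3.
      assert (norm (minus (plus (l n u) (l n v)) (plus (L u) (L v)))
        <= norm (minus (l n u) (L u)) + norm (minus (l n v) (L v)))
        by (apply norm_le_plus; module_eq Y).
      lra.
    + assert (HLs : forall (k : C_AbsRing) u, L (scal k u) = scal k (L u)); [|exact HLs].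
      intros k u. apply Heq. exists (K * norm (scal k u) + Cmod k * (K * norm u)). intros n.
      pose proof (HL n (scal k u)) as H1. pose proof (HL n u) as H2.
      assert (El : l n (scal k u) = scal k (l n u)) by apply (linear_scal (l n) (Hlin n)).
      rewrite El in H1.
      rewrite Rmult_plus_distr_r. eapply norm_minus_le_trans; [exact H1|].
      apply Rle_trans with (norm (scal (k : C_AbsRing) (minus (l n u) (L u)))).
      { apply Req_le, f_equal. module_eq Y. }
      eapply Rle_trans; [apply norm_scal_C|]. rewrite norm_minus_sym in H2.
      rewrite Rmult_assoc. now apply Rmult_le_compat_l; [apply Cmod_ge_0|].
    + destruct (linear_norm (l O) (Hlin O)) as [M [HM0 HM]].
      exists (M + K * e O). split.
      { apply Rplus_lt_0_compat; [easy|]. now apply Rmult_lt_0_compat. }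
      intros u.
      pose proof (HL O u). specialize (HM u).
      pose proof (norm_le_minus (L u) (l O u)). lra.
  - intros eps Heps.
    destruct (archimed_cor1 (eps / (3 * K))) as [[|n] [Hn Hn0]];
      [apply Rdiv_lt_0_compat; lra|lia|]. fold (e n) in Hn.
    apply (Rmult_lt_compat_r (3 * K)) in Hn; [|lra].
    unfold Rdiv in Hn. rewrite (Rmult_assoc eps), Rinv_l, Rmult_1_r in Hn by lra.
    destruct (filterdiff_bound (g n) (l n) x0 (eps / 3) (Hl n)) as [d [Hd Hdn]]; [lra|].
    exists (Rmin d (r / 2)). split; [apply Rmin_glb_lt; lra|]. intros x Hx.
    apply Rmin_Rgt_l in Hx. destruct Hx as [Hx1 Hx2].
    specialize (Hdn x Hx1). pose proof (HL n (minus x x0)) as H1. rewrite norm_minus_sym in H1.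
    assert (H2 : norm (minus (minus (f x) (g n x)) (minus (f x0) (g n x0)))
      <= K * norm (minus x x0) * e n).
    (* The Lipschitz bound is known for [g m' - g n] only. Replacing [g m'] by [f] at both points
       costs [2 * e m], which vanishes in the limit. *)
    { apply (Rle_of_all_inv _ _ 2). intros m. fold (e m).
      set (m' := Nat.max n m).
      pose proof (Hlip n m' x (Nat.le_max_l _ _) Hx2) as H2.
      pose proof (Hdec m m' (Nat.le_max_r _ _)).
      pose proof (Hg2 m' x ltac:(lra)) as H3. rewrite norm_minus_sym in H3.
      pose proof (Hg2 m' x0 ltac:(lra)) as H4.
      set (a := minus (minus (g m' x) (g n x)) (minus (g m' x0) (g n x0))) in *.
      assert (norm (plus (minus (f x) (g m' x)) (minus (g m' x0) (f x0)))
        <= norm (minus (f x) (g m' x)) + norm (minus (g m' x0) (f x0)))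
        by now apply norm_le_plus.
      assert (norm (minus (minus (f x) (g n x)) (minus (f x0) (g n x0)))
        <= norm a + norm (plus (minus (f x) (g m' x)) (minus (g m' x0) (f x0))))
        by (apply norm_le_plus; unfold a; module_eq Y).
      lra. }
    set (a := minus (minus (f x) (g n x)) (minus (f x0) (g n x0))) in *.
    set (b := minus (minus (g n x) (g n x0)) (l n (minus x x0))) in *.
    set (c := minus (l n (minus x x0)) (L (minus x x0))) in *.
    assert (norm (plus a b) <= norm a + norm b) by now apply norm_le_plus.
    assert (norm (minus (minus (f x) (f x0)) (L (minus x x0))) <= norm (plus a b) + norm c)
      by (apply norm_le_plus; unfold a, b, c; module_eq Y).
    pose proof (norm_ge_0 (minus x x0)). nra.
Qed.
End UniformLimit.

(** * Almost additive families *)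

Lemma dyadic_scale (s delta : R) :
  0 < s <= delta -> exists k, 2 ^ k * s <= delta < 2 ^ S k * s.
Proof.
  intros Hs.
  assert (Hex : exists n, delta < 2 ^ n * s).
  { destruct (Pow_x_infinity 2) with (b := delta / s + 1) as [n Hn];
      [rewrite Rabs_right; lra|].
    exists n. specialize (Hn n (le_n n)). rewrite Rabs_right in Hn
      by (apply Rle_ge, pow_le; lra).
    apply Rge_le in Hn. apply (Rmult_le_compat_r s) in Hn; [|lra].
    rewrite Rmult_plus_distr_r in Hn. unfold Rdiv in Hn.
    rewrite Rmult_assoc, Rinv_l, Rmult_1_r in Hn by lra. lra. }
  destruct Hex as [n Hn]. induction n as [|n IH].
  - simpl in Hn. lra.
  - destruct (Rlt_dec delta (2 ^ n * s)) as [Hlt|Hge]; [now apply IH|].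
    exists n. lra.
Qed.

Section AlmostAdditive.
Context {T : Type} {Y : NormedModule C_AbsRing}.

(** The bound [m] for [a t] is taken on the larger set [S], the defect on the smaller [S']: this is
    the loss of domain in the Cauchy estimate. Quantifying over [m] inside lets improved bounds for
    small [t] be fed back. *)
Definition additive_defect (a : R -> T -> Y) (delta C : R) (S S' : T -> Prop) : Prop :=
  forall t s m, 0 <= t -> 0 <= s -> t + s <= delta ->
    (forall x, S x -> norm (a t x) <= m) ->
    forall x, S' x ->
      norm (minus (a (t + s) x) (plus (a t x) (a s x))) <= C * m * norm (a s x).

Lemma additive_defect_weaken (a : R -> T -> Y) (delta K K' : R) (S S' : T -> Prop) :
  K <= K' -> (forall x, S' x -> S x) ->
  additive_defect a delta K S S' -> additive_defect a delta K' S S'.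
Proof.
  intros HK HS H t s m Ht Hs Hts Hm x Hx.
  eapply Rle_trans; [exact (H t s m Ht Hs Hts Hm x Hx)|].
  pose proof (norm_ge_0 (a t x)). specialize (Hm x (HS x Hx)).
  apply Rmult_le_compat_r; [apply norm_ge_0|]. apply Rmult_le_compat_r; lra.
Qed.

Lemma additive_defect_halving (a : R -> T -> Y) (delta C m t : R) (S S' : T -> Prop) :
  additive_defect a delta C S S' -> 0 <= t -> 2 * t <= delta ->
  (forall x, S x -> norm (a t x) <= m) ->
  forall x, S' x -> 2 * norm (a t x) <= norm (a (2 * t) x) + C * m * norm (a t x).
Proof.
  intros H Ht Htd Hm x Hx.
  specialize (H t t m Ht Ht ltac:(lra) Hm x Hx).
  replace (t + t) with (2 * t) in H by ring.
  pose proof (norm_le_scal 2 (a t x)) as H1. rewrite Cmod_R, Rabs_right in H1 by lra.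
  eapply Rle_trans; [exact H1|].
  rewrite Rplus_comm.
  eapply Rle_trans; [|apply Rplus_le_compat_r; exact H].
  rewrite norm_minus_sym. apply norm_le_plus.
  module_eq_in Y; C_eq.
Qed.

(** With [C * eta <= 1 / 2], halving gives [|a (t / 2)| <= 2/3 |a t|] on [S1], which iterates to a
    geometric decay. Using that decay as the bound [m], the error of the [k]-th halving on [S2] is
    of order [(4/9)^k], still summable after multiplication by [2 ^ k]. *)
Lemma linear_growth (a : R -> T -> Y) (delta C eta : R) (S0 S1 S2 : T -> Prop) :
  0 < delta -> 0 <= C -> 0 <= eta -> C * eta <= 1 / 2 ->
  (forall x, S2 x -> S1 x) -> (forall x, S1 x -> S0 x) ->
  additive_defect a delta C S0 S1 -> additive_defect a delta C S1 S2 ->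
  (forall t x, 0 <= t <= delta -> S0 x -> norm (a t x) <= eta) ->
  forall t x, 0 <= t <= delta -> S2 x -> norm (a t x) <= 6 * eta / delta * t.
Proof.
  intros Hdelta HC Heta HCeta H21 H10 D0 D1 Hsmall.
  assert (Hpow : forall k t, 0 <= t <= delta -> 0 <= t / 2 ^ k <= t).
  { intros k t Ht. assert (1 <= 2 ^ k) by (apply pow_R1_Rle; lra).
    split; [apply Rmult_le_pos; [lra|apply Rlt_le, Rinv_0_lt_compat; lra]|].
    apply (Rmult_le_reg_r (2 ^ k)); [lra|]. unfold Rdiv.
    rewrite Rmult_assoc, Rinv_l by lra. nra. }
  assert (Hdouble : forall k t, 2 * (t / 2 ^ S k) = t / 2 ^ k).
  { intros k t. simpl. field. apply pow_nonzero; lra. }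
  assert (HA : forall k t x, 0 <= t <= delta -> S1 x ->
    norm (a (t / 2 ^ k) x) <= eta * (2 / 3) ^ k).
  { intros k t x Ht Hx. induction k as [|k IH].
    - replace (t / 2 ^ 0) with t by (simpl; field).
      simpl. rewrite Rmult_1_r. apply Hsmall; auto.
    - destruct (Hpow (S k) t Ht). destruct (Hpow k t Ht).
      pose proof (additive_defect_halving a delta C eta (t / 2 ^ S k) S0 S1 D0
        ltac:(easy) ltac:(rewrite Hdouble; lra)
        ltac:(intros; apply Hsmall; [lra|easy]) x Hx) as H3.
      rewrite Hdouble in H3. pose proof (norm_ge_0 (a (t / 2 ^ S k) x)).
      change ((2 / 3) ^ S k) with (2 / 3 * (2 / 3) ^ k). nra. }
  (* The factor [3 - 2 * (8 / 9) ^ k] is 1 plus the sum of the errors [2 / 9 * (8 / 9) ^ j] for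
     [j < k]. *)
  assert (HB : forall k t x, 0 <= t <= delta -> S2 x ->
    2 ^ k * norm (a (t / 2 ^ k) x) <= eta * (3 - 2 * (8 / 9) ^ k)).
  { intros k t x Ht Hx. induction k as [|k IH].
    - replace (t / 2 ^ 0) with t by (simpl; field).
      simpl. pose proof (Hsmall t x Ht ltac:(auto)). lra.
    - destruct (Hpow (S k) t Ht). destruct (Hpow k t Ht).
      pose proof (additive_defect_halving a delta C (eta * (2 / 3) ^ S k) (t / 2 ^ S k) S1 S2 D1
        ltac:(easy) ltac:(rewrite Hdouble; lra)
        ltac:(intros; apply HA; easy) x Hx) as H3.
      rewrite Hdouble in H3. pose proof (HA (S k) t x Ht ltac:(auto)) as H4.
      pose proof (norm_ge_0 (a (t / 2 ^ S k) x)) as H5.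
      assert (H23 : 0 < (2 / 3) ^ S k) by (apply pow_lt; lra).
      assert (H6 : C * (eta * (2 / 3) ^ S k) * norm (a (t / 2 ^ S k) x)
        <= 1 / 2 * (2 / 3) ^ S k * (eta * (2 / 3) ^ S k)).
      { apply Rmult_le_compat; try easy.
        - apply Rmult_le_pos; [easy|]. apply Rmult_le_pos; lra.
        - rewrite <- Rmult_assoc. apply Rmult_le_compat_r; lra. }
      assert (H2k : 0 < 2 ^ k) by (apply pow_lt; lra).
      assert (E : 2 ^ k * (1 / 2 * (2 / 3) ^ S k * (eta * (2 / 3) ^ S k))
        = eta * (2 / 9 * (8 / 9) ^ k)).
      { replace (8 / 9) with (2 * (2 / 3) * (2 / 3)) by field.
        rewrite !Rpow_mult_distr. simpl. field. }
      change (2 ^ S k) with (2 * 2 ^ k) at 1.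
      change ((8 / 9) ^ S k) with (8 / 9 * (8 / 9) ^ k).
      assert (H7 : 2 ^ k * (2 * norm (a (t / 2 ^ S k) x)) <=
        2 ^ k * (norm (a (t / 2 ^ k) x) + 1 / 2 * (2 / 3) ^ S k * (eta * (2 / 3) ^ S k))).
      { apply Rmult_le_compat_l; lra. }
      rewrite Rmult_plus_distr_l, E in H7. lra. }
  intros t x Ht Hx.
  (* At time 0 the halving inequality reads [2 |a 0| <= |a 0| + |a 0| / 2] at worst, which forces
     [a 0] to vanish. *)
  destruct (Req_dec t 0) as [->|Ht0].
  { pose proof (additive_defect_halving a delta C eta 0 S0 S1 D0 ltac:(lra) ltac:(lra)
      ltac:(intros; apply Hsmall; [lra|easy]) x ltac:(auto)) as H3.
    rewrite Rmult_0_r in H3. pose proof (norm_ge_0 (a 0 x)). nra. }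
  (* Since [2 ^ k * t] exceeds [delta / 2], the bound [3 * eta / 2 ^ k] is at most
     [6 * eta / delta * t]. *)
  destruct (dyadic_scale t delta) as [k [Hk1 Hk2]]; [lra|].
  assert (H2k : 0 < 2 ^ k) by (apply pow_lt; lra).
  pose proof (HB k (2 ^ k * t) x ltac:(nra) Hx) as H.
  replace (2 ^ k * t / 2 ^ k) with t in H by (field; lra).
  assert (0 < (8 / 9) ^ k) by (apply pow_lt; lra).
  apply (Rmult_le_reg_l (2 ^ k)); [easy|].
  apply Rle_trans with (eta * 3); [nra|].
  replace (2 ^ k * (6 * eta / delta * t)) with (eta * 3 * (2 * 2 ^ k * t / delta)) by (field; lra).
  rewrite <- (Rmult_1_r (eta * 3)) at 1. apply Rmult_le_compat_l; [lra|].
  apply (Rmult_le_reg_r delta); [easy|]. unfold Rdiv.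
  rewrite Rmult_assoc, Rinv_l by lra. simpl in Hk2. lra.
Qed.
End AlmostAdditive.

(** * The derivative at 0 of an almost additive function of time *)

Section Derivative.
Context {Y : NormedModule C_AbsRing} (a : R -> Y) (delta K L : R).
Context (Hdelta : 0 < delta) (HK : 0 <= K) (HL : 0 <= L).
Context (Hgrowth : forall t, 0 <= t <= delta -> norm (a t) <= K * t).
Context (Hdefect : forall t s, 0 <= t -> 0 <= s -> t + s <= delta ->
  norm (minus (a (t + s)) (plus (a t) (a s))) <= L * t * s).

Lemma almost_additive_multiple (n : nat) (s : R) :
  0 <= s -> INR n * s <= delta ->
  norm (minus (a (INR n * s)) (scal (RtoC (INR n) : C_AbsRing) (a s)))
    <= L * (INR n * s) * (INR n * s).
Proof.
  intros Hs. induction n as [|n IH]; intros Hn.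
  - simpl in *. replace (minus (a (0 * s)) (scal (RtoC 0 : C_AbsRing) (a s)))
      with (a (0 * s)) by (module_eq_in Y; C_eq).
    rewrite Rmult_0_l in *. specialize (Hgrowth 0 ltac:(lra)). lra.
  - rewrite S_INR in *. pose proof (pos_INR n) as Hn0.
    replace ((INR n + 1) * s) with (INR n * s + s) in * by ring.
    specialize (IH ltac:(lra)).
    assert (Hns : 0 <= INR n * s) by nra.
    pose proof (Hdefect (INR n * s) s Hns Hs Hn) as H1.
    apply Rle_trans with (L * (INR n * s) * s + L * (INR n * s) * (INR n * s)).
    + eapply Rle_trans; [|apply Rplus_le_compat; [exact H1|exact IH]].
      apply norm_le_plus. module_eq_in Y; C_eq.
    + assert (0 <= L * (INR n * s) * s) by (repeat apply Rmult_le_pos; easy).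
      assert (0 <= L * s * s) by (repeat apply Rmult_le_pos; easy). nra.
Qed.

(** Write [t = n s + rho] with [0 <= rho < s]. Then [a t] is close to [n (a s) + a rho] with two
    errors of size [L t^2], and the two leftovers, [a rho] and [(rho / s) (a s)], are at most [K s]
    each. Division by [t] gives the claim. *)
Lemma difference_quotients_close (s t : R) :
  0 < s <= t -> t <= delta ->
  norm (minus (scal (RtoC (/ t) : C_AbsRing) (a t)) (scal (RtoC (/ s) : C_AbsRing) (a s)))
    <= 2 * L * t + 2 * K * s / t.
Proof.
  intros Hs Ht.
  destruct (nfloor_ex (t / s)) as [n [Hn1 Hn2]].
  { apply Rmult_le_pos; [lra|apply Rlt_le, Rinv_0_lt_compat; lra]. }
  apply (Rmult_le_compat_r s) in Hn1; [|lra].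
  apply (Rmult_lt_compat_r s) in Hn2; [|lra].
  replace (t / s * s) with t in Hn1, Hn2 by (field; lra).
  set (rho := t - INR n * s).
  assert (Hrho : 0 <= rho <= s) by (unfold rho; lra).
  pose proof (pos_INR n) as Hn0.
  assert (Hns : 0 <= INR n * s) by nra.
  pose proof (almost_additive_multiple n s ltac:(lra) ltac:(lra)) as H1.
  pose proof (Hdefect (INR n * s) rho Hns ltac:(lra) ltac:(unfold rho; lra)) as H2.
  replace (INR n * s + rho) with t in H2 by (unfold rho; ring).
  pose proof (Hgrowth rho ltac:(lra)) as H3.
  pose proof (Hgrowth s ltac:(lra)) as H4.
  set (u := a t) in *. set (v := a (INR n * s)) in *. set (w := a rho) in *. set (y := a s) in *.
  assert (H5 : norm (minus u (scal (RtoC (t / s) : C_AbsRing) y)) <=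
    norm (minus u (plus v w)) + (norm (minus v (scal (RtoC (INR n) : C_AbsRing) y)) +
      (norm w + norm (scal (RtoC (- (rho / s)) : C_AbsRing) y)))).
  { eapply Rle_trans; [|apply Rplus_le_compat_l; eapply Rle_trans;
      [|apply Rplus_le_compat_l; apply norm_triangle]; apply norm_triangle].
    eapply Rle_trans; [|apply norm_triangle].
    apply Req_le, f_equal. unfold rho. module_eq_in Y; C_eq; lra. }
  assert (H6 : norm (scal (RtoC (- (rho / s)) : C_AbsRing) y) <= K * s).
  { eapply Rle_trans; [apply norm_scal_R|]. rewrite Rabs_Ropp, Rabs_right.
    2: { apply Rle_ge, Rmult_le_pos; [lra|apply Rlt_le, Rinv_0_lt_compat; lra]. }
    apply Rle_trans with (rho / s * (K * s)).
    - apply Rmult_le_compat_l; [|easy].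
      apply Rmult_le_pos; [lra|apply Rlt_le, Rinv_0_lt_compat; lra].
    - replace (rho / s * (K * s)) with (K * rho) by (field; lra). nra. }
  assert (H7 : L * (INR n * s) * rho <= L * t * t).
  { repeat apply Rmult_le_compat; try nra; lra. }
  assert (H8 : L * (INR n * s) * (INR n * s) <= L * t * t).
  { repeat apply Rmult_le_compat; try nra; lra. }
  assert (H9 : K * rho <= K * s) by nra.
  apply Rle_trans with (norm (scal (RtoC (/ t) : C_AbsRing)
    (minus u (scal (RtoC (t / s) : C_AbsRing) y)))).
  { apply Req_le, f_equal. module_eq_in Y; C_eq; lra. }
  eapply Rle_trans; [apply norm_scal_R|].
  rewrite Rabs_right by (apply Rle_ge, Rlt_le, Rinv_0_lt_compat; lra).
  replace (2 * L * t + 2 * K * s / t) with (/ t * (2 * (L * t * t) + 2 * (K * s))) by (field; lra).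
  apply Rmult_le_compat_l; [apply Rlt_le, Rinv_0_lt_compat; lra|]. lra.
Qed.

(** For fixed [t] the term [2 * K * s / t] disappears as [s] tends to 0, so the limit of the
    quotients along [delta * e n] is approached at the rate [2 * L * t] alone. *)
Lemma almost_additive_derivative :
  norm_complete Y ->
  exists b : Y, forall t, 0 < t <= delta ->
    norm (minus (scal (RtoC (/ t) : C_AbsRing) (a t)) b) <= 2 * L * t.
Proof.
  intros Hcomplete.
  set (e := fun n : nat => / INR (S n)).
  assert (He : forall n, 0 < e n <= 1).
  { intros n. assert (1 <= INR (S n)) by (rewrite S_INR; pose proof (pos_INR n); lra).
    split; [apply Rinv_0_lt_compat; lra|].
    unfold e. rewrite <- Rinv_1. apply Rinv_le_contravar; lra. }
  assert (Hdec : forall n m, (n <= m)%nat -> e m <= e n).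
  { intros n m Hnm. apply Rinv_le_contravar; [apply lt_0_INR; lia|apply le_INR; lia]. }
  set (f := (fun n => scal (RtoC (/ (delta * e n)) : C_AbsRing) (a (delta * e n))) : nat -> Y).
  assert (Hf : forall t n, 0 < t <= delta -> delta * e n <= t ->
    norm (minus (scal (RtoC (/ t) : C_AbsRing) (a t)) (f n))
      <= 2 * L * t + 2 * K * delta / t * e n).
  { intros t n Ht Hn. destruct (He n).
    pose proof (difference_quotients_close (delta * e n) t ltac:(split; nra) ltac:(lra)) as H1.
    unfold f. replace (2 * K * delta / t * e n) with (2 * K * (delta * e n) / t); [exact H1|].
    field; lra. }
  destruct (Hcomplete f) as [b Hb].
  { intros eps Heps.
    set (M := 2 * (2 * L * delta + 2 * K) + 1).
    assert (HM : 0 < M) by (unfold M; nra).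
    destruct (archimed_cor1 (eps / M)) as [[|N] [HN HN0]]; [now apply Rdiv_lt_0_compat|lia|].
    fold (e N) in HN. apply (Rmult_lt_compat_r M) in HN; [|easy].
    unfold Rdiv in HN. rewrite (Rmult_assoc eps), Rinv_l, Rmult_1_r in HN by lra.
    (* Squaring the index makes the ratio of the two step lengths at most [e N], so the term with
       [K] is small as well. *)
    assert (HfN : forall n, (S N * S N <= S n)%nat ->
      norm (minus (f N) (f n)) <= 2 * L * (delta * e N) + 2 * K * e N).
    { intros n Hn. destruct (He N). destruct (He n).
      assert (Hen : e n <= e N * e N).
      { unfold e. rewrite <- Rinv_mult, <- mult_INR. apply Rinv_le_contravar.
        - apply lt_0_INR; lia.
        - now apply le_INR. }
      eapply Rle_trans; [apply (Hf (delta * e N) n)|].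
      - split; nra.
      - apply Rmult_le_compat_l; [lra|]. nra.
      - apply Rplus_le_compat_l.
        replace (2 * K * delta / (delta * e N) * e n) with (2 * K * (e n / e N)) by (field; lra).
        apply Rmult_le_compat_l; [lra|]. apply (Rmult_le_reg_r (e N)); [easy|].
        unfold Rdiv. rewrite Rmult_assoc, Rinv_l by lra. lra. }
    exists (S N * S N)%nat. intros n m Hn Hm.
    pose proof (HfN n ltac:(lia)) as H1. pose proof (HfN m ltac:(lia)) as H2.
    rewrite norm_minus_sym in H2.
    pose proof (norm_minus_triangle (f m) (f N) (f n)).
    unfold M in HN. destruct (He N). nra. }
  exists b. intros t Ht. apply le_epsilon. intros eps Heps.
  destruct (Hb (eps / 2)) as [N HN]; [lra|].
  set (M := 2 * K * delta / t + delta / t).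
  assert (HM : 0 < M).
  { apply Rplus_le_lt_0_compat; [|apply Rdiv_lt_0_compat; lra].
    apply Rmult_le_pos; [nra|apply Rlt_le, Rinv_0_lt_compat; lra]. }
  destruct (archimed_cor1 (Rmin 1 (eps / 2) / M)) as [[|N'] [HN' HN0]];
    [apply Rdiv_lt_0_compat; [apply Rmin_glb_lt; lra|easy]|lia|].
  set (n := Nat.max N N').
  assert (Hn : e n * M < Rmin 1 (eps / 2)).
  { apply Rle_lt_trans with (e N' * M).
    - apply Rmult_le_compat_r; [lra|]. apply Hdec, Nat.le_max_r.
    - fold (e N') in HN'. apply (Rmult_lt_compat_r M) in HN'; [|easy].
      unfold Rdiv in HN'. rewrite (Rmult_assoc (Rmin _ _)), Rinv_l, Rmult_1_r in HN' by lra.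
      easy. }
  apply Rmin_Rgt_l in Hn. destruct Hn as [Hn1 Hn2]. destruct (He n) as [Hen _].
  assert (0 <= 2 * K * delta / t).
  { apply Rmult_le_pos; [nra|apply Rlt_le, Rinv_0_lt_compat; lra]. }
  assert (0 < delta / t) by (apply Rdiv_lt_0_compat; lra).
  assert (Hlt : delta * e n <= t).
  { apply (Rmult_le_reg_r (/ t)); [apply Rinv_0_lt_compat; lra|].
    rewrite Rinv_r by lra. unfold M, Rdiv in *. nra. }
  pose proof (Hf t n Ht Hlt) as H1. pose proof (HN n (Nat.le_max_l _ _)) as H2.
  eapply Rle_trans; [eapply norm_minus_le_trans; [exact H1|apply Rlt_le, H2]|].
  unfold M in Hn2. nra.
Qed.
End Derivative.

(** * Semicocycles *)

(** Common form, on balls, of the two continuity notions of the theorem. The radius is chosen before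
    [eps]. *)
Definition locally_uniformly_continuous_at {X Y : NormedModule C_AbsRing}
    (D : X -> Prop) (f : R -> X -> Y) (t0 : R) : Prop :=
  forall x0, D x0 -> exists r, 0 < r /\ (forall x, norm (minus x x0) < r -> D x) /\
    forall eps, 0 < eps -> exists d, 0 < d /\
      forall t x, 0 <= t -> Rabs (t - t0) < d -> norm (minus x x0) < r ->
        norm (minus (f t x) (f t0 x)) <= eps.

Lemma norm_pair_le {X Y : NormedModule C_AbsRing} (x : X) (y : Y) (m : R) :
  norm x <= m -> norm y <= m ->
  norm ((x, y) : prod_NormedModule C_AbsRing X Y) <= 2 * m.
Proof.
  intros Hx Hy. eapply Rle_trans; [apply norm_prod|].
  assert (sqrt 2 <= 2).
  { rewrite <- (sqrt_square 2) at 2 by lra. apply sqrt_le_1; lra. }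
  pose proof (sqrt_pos 2). pose proof (norm_ge_0 x).
  assert (Rmax (norm x) (norm y) <= m) by now apply Rmax_lub.
  assert (0 <= Rmax (norm x) (norm y)) by (eapply Rle_trans; [apply (norm_ge_0 x)|apply Rmax_l]).
  nra.
Qed.

Section Cocycle.
Context {X A : NormedModule C_AbsRing} (mul : A -> A -> A) (one : A).
Context (mul_one_l : forall a, mul one a = a) (mul_one_r : forall a, mul a one = a).
Context (mul_plus_l : forall a b c, mul (plus a b) c = plus (mul a c) (mul b c)).
Context (mul_plus_r : forall a b c, mul a (plus b c) = plus (mul a b) (mul a c)).
Context (mul_scal_l : forall (k : C) a b,
  mul (scal (k : C_AbsRing) a) b = scal (k : C_AbsRing) (mul a b)).
Context (norm_mul : forall a b, norm (mul a b) <= norm a * norm b).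
Context (norm_one : norm one = 1).
Context (D : X -> Prop) (F : R -> X -> X) (G : R -> X -> A).
Context (F_self : forall t x, 0 <= t -> D x -> D (F t x)).
Context (F_0 : forall x, D x -> F 0 x = x) (G_0 : forall x, D x -> G 0 x = one).
Context (F_plus : forall t s x, 0 <= t -> 0 <= s -> D x -> F (t + s) x = F t (F s x)).
Context (G_plus : forall t s x, 0 <= t -> 0 <= s -> D x ->
  G (t + s) x = mul (G t (F s x)) (G s x)).
Context (F_hol : forall t x, 0 <= t -> D x -> ex_filterdiff (F t) (locally x)).
Context (G_hol : forall t x, 0 <= t -> D x -> ex_filterdiff (G t) (locally x)).
Context (F_luc : forall t, 0 <= t -> locally_uniformly_continuous_at D F t).

Lemma mul_minus_l (a b c : A) : mul (minus a b) c = minus (mul a c) (mul b c).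
Proof.
  assert (H : mul a c = plus (mul (minus a b) c) (mul b c)).
  { rewrite <- mul_plus_l. f_equal. module_eq A. }
  rewrite H. module_eq A.
Qed.

Lemma mul_minus_r (a b c : A) : mul a (minus b c) = minus (mul a b) (mul a c).
Proof.
  assert (H : mul a b = plus (mul a (minus b c)) (mul a c)).
  { rewrite <- mul_plus_r. f_equal. module_eq A. }
  rewrite H. module_eq A.
Qed.

Definition displacement (t : R) (x : X) : prod_NormedModule C_AbsRing X A :=
  (minus (F t x) x, minus (G t x) one).

Lemma displacement_fst (t : R) (x : X) : norm (minus (F t x) x) <= norm (displacement t x).
Proof. exact (norm_le_prod_norm_1 (displacement t x)). Qed.

Lemma displacement_snd (t : R) (x : X) : norm (minus (G t x) one) <= norm (displacement t x).
Proof. exact (norm_le_prod_norm_2 (displacement t x)). Qed.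

(** In the first component the defect is the increment of [F t - id] between [x] and [F s x]. In the
    second, with [u = G t (F s x) - 1] and [w = G s x - 1], the product is [1 + u + w + u w], so the
    defect is the increment of [G t - 1] plus [u w]. The hypothesis on [F] keeps [F s x] in the half
    ball where the Lipschitz constant is [8 m / rho]; the outer factor 2 comes from the norm of a
    pair. *)
Lemma displacement_defect (x0 : X) (delta rho : R) :
  0 < rho ->
  (forall x, norm (minus x x0) < rho -> D x) ->
  (forall t x, 0 <= t <= delta -> norm (minus x x0) < rho ->
     norm (minus (F t x) x) <= rho / 4) ->
  additive_defect displacement delta (2 * (8 / rho + 1))
    (fun x => norm (minus x x0) < rho) (fun x => norm (minus x x0) < rho / 4).
Proof.
  intros Hrho HD HF t s m Ht Hs Hts Hm x Hx.
  assert (HFx : norm (minus (F s x) x0) < rho / 2).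
  { pose proof (norm_minus_triangle (F s x) x x0). specialize (HF s x ltac:(lra) ltac:(lra)). lra. }
  assert (HDx : D x) by (apply HD; lra).
  assert (Hm0 : 0 <= m) by (eapply Rle_trans; [apply (norm_ge_0 (displacement t x))|apply Hm; lra]).
  set (v := norm (displacement s x)).
  assert (Hv : 0 <= v) by apply norm_ge_0.
  assert (H8 : 0 <= 8 * m / rho).
  { apply Rmult_le_pos; [lra|apply Rlt_le, Rinv_0_lt_compat; lra]. }
  assert (HFs : norm (minus (F s x) x) <= v) by apply displacement_fst.
  assert (HGs : norm (minus (G s x) one) <= v) by apply displacement_snd.
  assert (HLF : norm (minus (minus (F t (F s x)) (F s x)) (minus (F t x) x)) <= 8 * m / rho * v).
  { eapply Rle_trans.
    - apply (lipschitz_of_bounded (fun x => minus (F t x) x) x0 x (F s x) rho m);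
        try easy; try lra.
      + intros z Hz. destruct (F_hol t z Ht (HD z Hz)) as [l Hl]. eexists.
        apply (filterdiff_minus_fct (F t) (fun x => x)); [exact Hl|apply filterdiff_id].
      + intros z Hz. eapply Rle_trans; [apply displacement_fst|now apply Hm].
    - now apply Rmult_le_compat_l. }
  assert (HLG : norm (minus (minus (G t (F s x)) one) (minus (G t x) one)) <= 8 * m / rho * v).
  { eapply Rle_trans.
    - apply (lipschitz_of_bounded (fun x => minus (G t x) one) x0 x (F s x) rho m);
        try easy; try lra.
      + intros z Hz. destruct (G_hol t z Ht (HD z Hz)) as [l Hl]. eexists.
        apply (filterdiff_minus_fct (G t) (fun _ => one)); [exact Hl|apply filterdiff_const].
      + intros z Hz. eapply Rle_trans; [apply displacement_snd|now apply Hm].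
    - now apply Rmult_le_compat_l. }
  replace (2 * (8 / rho + 1) * m * v) with (2 * (8 * m / rho * v + m * v)) by (field; lra).
  apply (norm_pair_le (X := X) (Y := A)).
  - simpl fst. rewrite F_plus by easy.
    apply Rle_trans with (8 * m / rho * v); [|nra].
    eapply Rle_trans; [|exact HLF]. apply Req_le, f_equal.
    set (p := F t (F s x)). set (q := F s x). set (p' := F t x). module_eq X.
  - simpl snd. rewrite G_plus by easy.
    set (u := minus (G t (F s x)) one) in *. set (w := minus (G s x) one) in *.
    assert (E : mul (G t (F s x)) (G s x) = plus (plus (mul u w) (plus u w)) one).
    { replace (G t (F s x)) with (plus u one) by (unfold u; module_eq A).
      replace (G s x) with (plus w one) by (unfold w; module_eq A).
      rewrite mul_plus_l, !mul_plus_r, mul_one_l, mul_one_r, mul_one_l. module_eq A. }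
    rewrite E.
    apply Rle_trans with (norm (minus u (minus (G t x) one)) + norm (mul u w)).
    { apply norm_le_plus. unfold w. module_eq A. }
    apply Rplus_le_compat; [exact HLG|].
    eapply Rle_trans; [apply norm_mul|].
    apply Rmult_le_compat; try apply norm_ge_0; [|exact HGs].
    eapply Rle_trans; [apply displacement_snd|apply Hm; lra].
Qed.

(** Linear growth uses up the balls of radii [r], [r / 4] and [r / 16]; its bound on the last one,
    put into the defect, yields an [O (t s)] defect on the ball of radius [r / 64]. *)
Lemma local_generator (x0 : X) :
  norm_complete A -> locally_uniformly_continuous_at D G 0 -> D x0 ->
  exists r d L, 0 < r /\ 0 < d /\ 0 <= L /\
    forall x, norm (minus x x0) < r -> D x /\
      exists b : A, forall t, 0 < t <= d ->
        norm (minus (scal (RtoC (/ t) : C_AbsRing) (minus (G t x) one)) b) <= L * t.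
Proof.
  intros Hcomplete G_luc Hx0.
  destruct (F_luc 0 (Rle_refl 0) x0 Hx0) as [r1 [Hr1 [HD1 HF]]].
  destruct (G_luc x0 Hx0) as [r2 [Hr2 [HD2 HG]]].
  set (r := Rmin r1 r2).
  assert (Hr : 0 < r) by now apply Rmin_glb_lt.
  assert (Hrr1 : r <= r1) by apply Rmin_l. assert (Hrr2 : r <= r2) by apply Rmin_r.
  (* The defect constant for radius [r / 16], the smallest on which a Cauchy estimate is made; it
     serves the larger radii too. *)
  set (K := 2 * (8 * 16 / r + 1)).
  assert (Hir : 0 < / r) by now apply Rinv_0_lt_compat.
  assert (HK : 0 < K) by (unfold K, Rdiv; lra).
  (* The first bound keeps displacements below a quarter of every radius used, the second is the
     smallness demanded by [linear_growth]. *)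
  set (eta := Rmin (r / 64) (/ (2 * K))).
  assert (Heta : 0 < eta).
  { apply Rmin_glb_lt; [lra|]. apply Rinv_0_lt_compat; lra. }
  assert (Heta1 : eta <= r / 64) by apply Rmin_l.
  assert (Heta2 : K * eta <= 1 / 2).
  { apply Rle_trans with (K * / (2 * K)).
    - apply Rmult_le_compat_l; [lra|apply Rmin_r].
    - apply Req_le. field. lra. }
  destruct (HF (eta / 2)) as [d1 [Hd1 HF']]; [lra|].
  destruct (HG (eta / 2)) as [d2 [Hd2 HG']]; [lra|].
  set (d := Rmin d1 d2 / 2).
  assert (Hd : 0 < d) by (assert (0 < Rmin d1 d2) by (now apply Rmin_glb_lt); unfold d; lra).
  assert (Hdd1 : d < d1) by (pose proof (Rmin_l d1 d2); unfold d in *; lra).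
  assert (Hdd2 : d < d2) by (pose proof (Rmin_r d1 d2); unfold d in *; lra).
  assert (HD : forall x, norm (minus x x0) < r -> D x) by (intros x Hx; apply HD1; lra).
  assert (HFs : forall t x, 0 <= t <= d -> norm (minus x x0) < r ->
    norm (minus (F t x) x) <= eta / 2).
  { intros t x Ht Hx. rewrite <- (F_0 x (HD x Hx)) at 2.
    apply HF'; try lra. rewrite Rabs_right; lra. }
  assert (HGs : forall t x, 0 <= t <= d -> norm (minus x x0) < r ->
    norm (minus (G t x) one) <= eta / 2).
  { intros t x Ht Hx. rewrite <- (G_0 x (HD x Hx)).
    apply HG'; try lra. rewrite Rabs_right; lra. }
  assert (Hdef : forall k, 1 <= k <= 16 -> additive_defect displacement d K
    (fun x => norm (minus x x0) < r / k) (fun x => norm (minus x x0) < r / k / 4)).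
  { intros k Hk.
    assert (Hik : 1 / 16 <= / k <= 1).
    { split.
      - unfold Rdiv; rewrite Rmult_1_l. apply Rinv_le_contravar; lra.
      - rewrite <- Rinv_1. apply Rinv_le_contravar; lra. }
    assert (Hrk : 0 < r / k <= r) by (unfold Rdiv; nra).
    assert (Hrk16 : r / 16 <= r / k) by (unfold Rdiv; nra).
    apply (additive_defect_weaken _ _ (2 * (8 / (r / k) + 1))).
    - unfold K. replace (8 / (r / k)) with (8 * k / r) by (field; lra).
      unfold Rdiv. nra.
    - intros x Hx. lra.
    - apply displacement_defect; [lra| |].
      + intros x Hx. apply HD; lra.
      + intros t x Ht Hx. specialize (HFs t x Ht ltac:(lra)). lra. }
  assert (Hgrow : forall t x, 0 <= t <= d -> norm (minus x x0) < r / 4 / 4 ->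
    norm (displacement t x) <= 6 * eta / d * t).
  { apply (linear_growth displacement d K eta
      (fun x => norm (minus x x0) < r / 1) (fun x => norm (minus x x0) < r / 1 / 4)
      (fun x => norm (minus x x0) < r / 4 / 4)); try lra.
    - intros x Hx. lra.
    - intros x Hx. lra.
    - apply Hdef; lra.
    - replace (r / 1 / 4) with (r / 4) by field. apply Hdef; lra.
    - intros t x Ht Hx. replace eta with (2 * (eta / 2)) by field.
      apply norm_pair_le; [apply HFs|apply HGs]; lra. }
  set (M := 6 * eta / d) in *.
  assert (HM : 0 <= M).
  { apply Rmult_le_pos; [lra|apply Rlt_le, Rinv_0_lt_compat; lra]. }
  exists (r / 64), d, (2 * (K * M * M)).
  assert (HKM : 0 <= K * M * M) by (apply Rmult_le_pos; [apply Rmult_le_pos; lra|lra]).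
  repeat split; try lra; [apply HD; lra|].
  apply (almost_additive_derivative (fun t => minus (G t x) one) d M (K * M * M)); try easy.
  - intros t Ht. eapply Rle_trans; [apply displacement_snd|]. apply Hgrow; lra.
  - intros t s Ht Hs Hts.
    (* Linear growth enters twice, as the bound [M * t] on the larger ball and below as [M * s] at
       the point itself. *)
    assert (Hdts := Hdef 16 ltac:(lra) t s (M * t) Ht Hs Hts).
    specialize (Hdts ltac:(intros y Hy; apply Hgrow; lra) x ltac:(lra)).
    apply Rle_trans with (K * (M * t) * norm (displacement s x)).
    + eapply Rle_trans; [|exact Hdts].
      exact (norm_le_prod_norm_2 (minus (displacement (t + s) x)
        (plus (displacement t x) (displacement s x)))).
    + replace (K * M * M * t * s) with (K * (M * t) * (M * s)) by ring.
      apply Rmult_le_compat_l; [|apply Hgrow; lra].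
      apply Rmult_le_pos; [lra|]. now apply Rmult_le_pos.
Qed.

(** * From time 0 to all times, and the differential equation *)

Lemma cocycle_increment (t h : R) (x : X) :
  0 <= t -> 0 <= h -> D x ->
  minus (G (t + h) x) (G t x) = mul (minus (G h (F t x)) one) (G t x).
Proof.
  intros Ht Hh Hx. rewrite Rplus_comm, G_plus, mul_minus_l, mul_one_l by easy. easy.
Qed.

(** The increment between [t] and [t0] is written from the earlier of the two times, at a point of
    the orbit near [F t0 x0], where [G h] is uniformly close to the unit for small [h]. *)
Lemma locally_uniformly_continuous_of_0 (t0 : R) :
  locally_uniformly_continuous_at D G 0 -> 0 <= t0 ->
  locally_uniformly_continuous_at D G t0.
Proof.
  intros G_luc Ht0 x0 Hx0.
  destruct (G_luc (F t0 x0) (F_self t0 x0 Ht0 Hx0)) as [r [Hr [HDr HG]]].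
  destruct (F_luc t0 Ht0 x0 Hx0) as [r1 [Hr1 [HD1 HF]]].
  destruct (HF (r / 3)) as [d1 [Hd1 HF1]]; [lra|].
  destruct (ex_filterdiff_continuous (F t0) x0 (r / 3)) as [r2 [Hr2 HF2]];
    [now apply F_hol|lra|].
  destruct (ex_filterdiff_continuous (G t0) x0 1) as [r3 [Hr3 HG3]];
    [now apply G_hol|lra|].
  exists (Rmin r1 (Rmin r2 r3)). split; [repeat apply Rmin_glb_lt; easy|].
  assert (Hball : forall x, norm (minus x x0) < Rmin r1 (Rmin r2 r3) ->
    norm (minus x x0) < r1 /\ norm (minus x x0) < r2 /\ norm (minus x x0) < r3).
  { intros x Hx. apply Rmin_Rgt_l in Hx. destruct Hx as [Ha Hx].
    apply Rmin_Rgt_l in Hx. easy. }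
  split; [intros x Hx; apply HD1; now apply Hball|].
  intros eps Heps.
  set (M := norm (G t0 x0) + 1).
  assert (HM : 1 <= M) by (pose proof (norm_ge_0 (G t0 x0)); unfold M; lra).
  (* For [t < t0] the increment is bounded by [e * norm (G t x)], with no bound on [G t x] at hand;
     [e <= 1 / 2] lets it be absorbed and gives [norm (G t x) <= 2 * M]. *)
  set (e := Rmin (1 / 2) (eps / (2 * M))).
  assert (He : 0 < e) by (apply Rmin_glb_lt; [lra|apply Rdiv_lt_0_compat; lra]).
  assert (He1 : e <= 1 / 2) by apply Rmin_l.
  assert (He2 : e * (2 * M) <= eps).
  { apply Rle_trans with (eps / (2 * M) * (2 * M)).
    - apply Rmult_le_compat_r; [lra|apply Rmin_r].
    - apply Req_le. field. lra. }
  destruct (HG e He) as [d2 [Hd2 HG2]].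
  exists (Rmin d1 d2). split; [now apply Rmin_glb_lt|].
  intros t x Ht Htd Hx. apply Rmin_Rgt_l in Htd. destruct Htd as [Htd1 Htd2].
  destruct (Hball x Hx) as [Hx1 [Hx2 Hx3]].
  assert (HDx : D x) by now apply HD1.
  assert (HFr : forall u, 0 <= u -> Rabs (u - t0) < d1 -> norm (minus (F u x) (F t0 x0)) < r).
  { intros u Hu Hud. specialize (HF1 u x Hu Hud Hx1). specialize (HF2 x Hx2).
    pose proof (norm_minus_triangle (F u x) (F t0 x) (F t0 x0)). lra. }
  assert (HMx : norm (G t0 x) <= M).
  { specialize (HG3 x Hx3). pose proof (norm_le_minus (G t0 x) (G t0 x0)). unfold M. lra. }
  assert (Hinc : forall u h, 0 <= u -> 0 <= h -> h < d2 -> Rabs (u - t0) < d1 ->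
    norm (minus (G (u + h) x) (G u x)) <= e * norm (G u x)).
  { intros u h Hu Hh Hhd Hud. rewrite cocycle_increment by easy.
    eapply Rle_trans; [apply norm_mul|]. apply Rmult_le_compat_r; [apply norm_ge_0|].
    rewrite <- (G_0 (F u x)) by now apply F_self.
    apply HG2; [easy| |now apply HFr]. rewrite Rminus_0_r, Rabs_right; lra. }
  destruct (Rle_dec t0 t) as [Hle|Hlt].
  - rewrite Rabs_right in Htd2 by lra.
    specialize (Hinc t0 (t - t0) Ht0 ltac:(lra) ltac:(lra)
      ltac:(rewrite Rminus_diag, Rabs_R0; lra)).
    replace (t0 + (t - t0)) with t in Hinc by ring. nra.
  - rewrite Rabs_left in Htd2 by lra.
    specialize (Hinc t (t0 - t) Ht ltac:(lra) ltac:(lra) Htd1).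
    replace (t + (t0 - t)) with t0 in Hinc by ring. rewrite norm_minus_sym in Hinc.
    pose proof (norm_le_minus (G t x) (G t0 x)) as H1.
    pose proof (norm_ge_0 (G t x)). nra.
Qed.

Definition generates (B : X -> A) : Prop :=
  forall x t, D x -> 0 <= t -> forall eps, 0 < eps ->
    exists d, 0 < d /\ forall s, 0 <= s -> s <> t -> Rabs (s - t) < d ->
      norm (minus (scal (RtoC (/ (s - t)) : C_AbsRing) (minus (G s x) (G t x)))
        (mul (B (F t x)) (G t x))) < eps.

(** Gronwall's inequality for [G t x - 1], along the part of the orbit where
    [B] is bounded by [M]. *)
Lemma generated_growth (B : X -> A) (x : X) (delta M : R) :
  generates B -> D x -> 0 <= M ->
  (forall t, 0 <= t <= delta -> norm (B (F t x)) <= M) ->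
  forall t, 0 <= t <= delta -> norm (minus (G t x) one) <= exp ((M + 1) * t) - 1.
Proof.
  intros HB Hx HM HBM.
  assert (Hinc : forall t eps, 0 <= t <= delta -> 0 < eps -> exists d, 0 < d /\
    forall s, 0 <= s -> Rabs (s - t) < d ->
      norm (minus (G s x) (G t x)) <= Rabs (s - t) * (M * norm (G t x) + eps)).
  { intros t eps Ht Heps. destruct (HB x t Hx ltac:(easy) eps Heps) as [d [Hd Hs]].
    exists d; split; [easy|]. intros s Hs0 Hsd.
    destruct (Req_dec s t) as [->|Hst].
    { replace (minus (G t x) (G t x)) with (zero : A) by module_eq A.
      rewrite norm_zero, Rminus_diag, Rabs_R0. lra. }
    specialize (Hs s Hs0 Hst Hsd).
    set (y := mul (B (F t x)) (G t x)) in *.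
    assert (Hy : norm y <= M * norm (G t x)).
    { eapply Rle_trans; [apply norm_mul|]. apply Rmult_le_compat_r; [apply norm_ge_0|].
      now apply HBM. }
    apply Rle_trans with (norm (scal (RtoC (s - t) : C_AbsRing)
      (plus (minus (scal (RtoC (/ (s - t)) : C_AbsRing) (minus (G s x) (G t x))) y) y))).
    { apply Req_le, f_equal. module_eq_in A; C_eq; lra. }
    eapply Rle_trans; [apply norm_scal_R|].
    apply Rmult_le_compat_l; [apply Rabs_pos|].
    eapply Rle_trans; [apply norm_triangle|]. lra. }
  apply real_induction.
  - rewrite G_0, Rmult_0_r, exp_0 by easy.
    replace (minus one one) with (zero : A) by module_eq A. rewrite norm_zero. lra.
  - intros t Ht IH. specialize (IH t ltac:(lra)).
    (* The tolerance 1 is paid for by the rate [M + 1]: since [E >= 1], [M * norm (G t x) + 1] is at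
       most [(M + 1) * E]. *)
    destruct (Hinc t 1) as [d [Hd Hs]]; [lra|lra|].
    exists d; split; [easy|]. intros h Hh.
    specialize (Hs (t + h) ltac:(lra)).
    replace (t + h - t) with h in Hs by ring. rewrite Rabs_right in Hs by lra.
    specialize (Hs ltac:(lra)).
    pose proof (norm_minus_triangle (G (t + h) x) (G t x) one) as H1.
    pose proof (norm_le_minus (G t x) one) as H2. rewrite norm_one in H2.
    rewrite Rmult_plus_distr_l, exp_plus.
    pose proof (exp_ineq1_le ((M + 1) * h)) as H3.
    assert (H4 : 1 <= exp ((M + 1) * t)).
    { pose proof (exp_ineq1_le ((M + 1) * t)). nra. }
    set (E := exp ((M + 1) * t)) in *.
    assert (H5 : E * (1 + (M + 1) * h) <= E * exp ((M + 1) * h)).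
    { apply Rmult_le_compat_l; lra. }
    assert (H6 : h * (M * norm (G t x) + 1) <= h * ((M + 1) * E)).
    { apply Rmult_le_compat_l; [lra|]. nra. }
    lra.
  - intros t Ht IH. apply le_epsilon. intros eps Heps.
    destruct (Hinc t 1) as [d [Hd Hs]]; [lra|lra|].
    set (c := M * norm (G t x) + 1) in *.
    assert (Hc : 1 <= c) by (pose proof (norm_ge_0 (G t x)); unfold c; nra).
    set (h := Rmin (Rmin (d / 2) t) (eps / c)).
    assert (Hh : 0 < h).
    { repeat apply Rmin_glb_lt; try lra. apply Rdiv_lt_0_compat; lra. }
    assert (Hh1 : h <= Rmin (d / 2) t) by apply Rmin_l.
    pose proof (Rmin_l (d / 2) t). pose proof (Rmin_r (d / 2) t).
    assert (Hhc : h * c <= eps).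
    { apply Rle_trans with (eps / c * c).
      - apply Rmult_le_compat_r; [lra|apply Rmin_r].
      - apply Req_le. field. lra. }
    specialize (Hs (t - h) ltac:(lra)).
    replace (t - h - t) with (- h) in Hs by ring.
    rewrite Rabs_Ropp, Rabs_right in Hs by lra. specialize (Hs ltac:(lra)).
    specialize (IH (t - h) ltac:(lra)). rewrite norm_minus_sym in Hs.
    pose proof (norm_minus_triangle (G t x) (G (t - h) x) one) as H1.
    assert (exp ((M + 1) * (t - h)) <= exp ((M + 1) * t)).
    { apply Rlt_le, exp_increasing. nra. }
    lra.
Qed.

(** Near [x0] the norm of [B] is at most [M] by continuity, and for short times the orbits starting
    close to [x0] stay in that neighbourhood, so the Gronwall bound holds with one constant for all
    of them. *)
Lemma generated_locally_uniformly_continuous (B : X -> A) :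
  generates B -> (forall x, D x -> ex_filterdiff B (locally x)) ->
  locally_uniformly_continuous_at D G 0.
Proof.
  intros HB B_hol x0 Hx0.
  destruct (ex_filterdiff_continuous B x0 1) as [r1 [Hr1 HB1]]; [auto|lra|].
  destruct (F_luc 0 (Rle_refl 0) x0 Hx0) as [r2 [Hr2 [HD2 HF]]].
  destruct (HF (r1 / 3)) as [d1 [Hd1 HF1]]; [lra|].
  set (M := norm (B x0) + 1).
  assert (HM : 0 <= M) by (pose proof (norm_ge_0 (B x0)); unfold M; lra).
  exists (Rmin (r1 / 2) r2). split; [apply Rmin_glb_lt; lra|].
  split; [intros x Hx; apply HD2; eapply Rlt_le_trans; [exact Hx|apply Rmin_r]|].
  intros eps Heps.
  assert (Hln : 0 < ln (1 + eps)) by (rewrite <- ln_1; apply ln_increasing; lra).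
  (* The second time is the one at which [exp ((M + 1) * t) - 1] reaches [eps]. *)
  exists (Rmin (d1 / 2) (ln (1 + eps) / (M + 1))).
  split; [apply Rmin_glb_lt; [lra|apply Rdiv_lt_0_compat; lra]|].
  intros t x Ht Htd Hx. apply Rmin_Rgt_l in Hx. destruct Hx as [Hx1 Hx2].
  rewrite Rminus_0_r, Rabs_right in Htd by lra.
  apply Rmin_Rgt_l in Htd. destruct Htd as [Htd1 Htd2].
  assert (HDx : D x) by now apply HD2.
  rewrite G_0 by easy.
  eapply Rle_trans.
  - apply (generated_growth B x t M HB HDx HM); [|lra].
    intros s Hs.
    assert (Hsd : Rabs (s - 0) < d1) by (rewrite Rminus_0_r, Rabs_right; lra).
    specialize (HF1 s x ltac:(lra) Hsd Hx2). rewrite F_0 in HF1 by easy.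
    pose proof (norm_minus_triangle (F s x) x x0) as H1.
    specialize (HB1 (F s x) ltac:(lra)).
    pose proof (norm_le_minus (B (F s x)) (B x0)). unfold M. lra.
  - apply (Rmult_lt_compat_l (M + 1)) in Htd2; [|lra].
    replace ((M + 1) * (ln (1 + eps) / (M + 1))) with (ln (1 + eps)) in Htd2 by (field; lra).
    apply exp_increasing in Htd2. rewrite exp_ln in Htd2 by lra. lra.
Qed.

(** At time [t] the difference quotient between [s] and [t] is read from the earlier time [u]: it is
    the quotient at 0 of step [|s - t|], taken at [F u x], times [G u x]. This covers both sides of
    [t]. The base point moves with [s], and the rate [L * h], uniform near [F t x], makes the limit
    go through. *)
Lemma generator_exists :
  norm_complete A -> locally_uniformly_continuous_at D G 0 ->
  exists B : X -> A, (forall x, D x -> ex_filterdiff B (locally x)) /\ generates B.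
Proof.
  intros Hcomplete G_luc.
  set (quot := fun t x => scal (RtoC (/ t) : C_AbsRing) (minus (G t x) one) : A).
  (* The constants of [local_generator] depend on the centre of the ball, so [B] is fixed pointwise
     as a limit of quotients; uniqueness of that limit identifies it with each local [b]. *)
  set (B := fun x => epsilon (inhabits one) (fun b : A => forall eps, 0 < eps ->
    exists d, 0 < d /\ forall t, 0 < t <= d -> norm (minus (quot t x) b) <= eps)).
  assert (HB : forall x0, D x0 -> exists r d L, 0 < r /\ 0 < d /\ 0 <= L /\
    forall x, norm (minus x x0) < r -> D x /\
      forall t, 0 < t <= d -> norm (minus (quot t x) (B x)) <= L * t).
  { intros x0 Hx0.
    destruct (local_generator x0 Hcomplete G_luc Hx0) as [r [d [L [Hr [Hd [HL H]]]]]].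
    exists r, d, L. repeat split; try easy; [now apply H|]. rename H0 into Hx.
    destruct (H x Hx) as [HDx [b Hb]].
    enough (Hb' : B x = b) by (now rewrite Hb').
    assert (HBx : forall eps, 0 < eps ->
      exists d, 0 < d /\ forall t, 0 < t <= d -> norm (minus (quot t x) (B x)) <= eps).
    { apply (epsilon_spec (inhabits one) (fun b : A => forall eps, 0 < eps ->
        exists d, 0 < d /\ forall t, 0 < t <= d -> norm (minus (quot t x) b) <= eps)).
      exists b. intros eps Heps.
      assert (HL1 : 0 < eps / (L + 1)) by (apply Rdiv_lt_0_compat; lra).
      exists (Rmin d (eps / (L + 1))). split; [now apply Rmin_glb_lt|].
      intros t [Ht Htd]. pose proof (Rmin_l d (eps / (L + 1))).
      pose proof (Rmin_r d (eps / (L + 1))).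
      eapply Rle_trans; [apply Hb; lra|].
      apply Rle_trans with ((L + 1) * (eps / (L + 1))).
      - apply Rmult_le_compat; lra.
      - apply Req_le. field. lra. }
    assert (Hz : norm (minus (B x) b) <= 0).
    { apply le_epsilon. intros eps Heps. rewrite Rplus_0_l.
      destruct (HBx (eps / 2)) as [d' [Hd' H']]; [lra|].
      set (t := Rmin (Rmin d d') (eps / 2 / (L + 1))).
      assert (Ht : 0 < t).
      { repeat apply Rmin_glb_lt; try easy. apply Rdiv_lt_0_compat; lra. }
      assert (Ht1 : t <= Rmin d d') by apply Rmin_l.
      pose proof (Rmin_l d d'). pose proof (Rmin_r d d').
      specialize (H' t ltac:(lra)). rewrite norm_minus_sym in H'.
      specialize (Hb t ltac:(lra)).
      assert (HLt : L * t <= (L + 1) * (eps / 2 / (L + 1))).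
      { apply Rmult_le_compat; try lra. apply Rmin_r. }
      replace ((L + 1) * (eps / 2 / (L + 1))) with (eps / 2) in HLt by (field; lra).
      replace eps with (eps / 2 + eps / 2) by field.
      eapply norm_minus_le_trans; [exact H'|]. eapply Rle_trans; [exact Hb|exact HLt]. }
    replace (B x) with (plus (minus (B x) b) b) by module_eq A.
    rewrite (norm_eq_zero (minus (B x) b)); [apply plus_zero_l|].
    apply Rle_antisym; [easy|apply norm_ge_0]. }
  assert (B_hol : forall x, D x -> ex_filterdiff B (locally x)).
  { intros x0 Hx0. destruct (HB x0 Hx0) as [r [d [L [Hr [Hd [HL H]]]]]].
    apply (ex_filterdiff_uniform_limit B x0 r Hcomplete Hr). intros eps Heps.
    set (t := Rmin d (eps / (L + 1))).
    assert (HL1 : 0 < eps / (L + 1)) by (apply Rdiv_lt_0_compat; lra).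
    assert (Ht : 0 < t) by now apply Rmin_glb_lt.
    assert (Ht1 : t <= d) by apply Rmin_l.
    exists (quot t). split; intros x Hx.
    - destruct (G_hol t x ltac:(lra) (proj1 (H x Hx))) as [l Hl].
      eexists. unfold quot.
      apply (filterdiff_comp' (fun x => minus (G t x) one)
        (fun y => scal (RtoC (/ t) : C_AbsRing) y) x (fun u => minus (l u) zero)
        (fun y => scal (RtoC (/ t) : C_AbsRing) y)).
      + apply (filterdiff_minus_fct (G t) (fun _ => one)); [exact Hl|apply filterdiff_const].
      + apply filterdiff_linear, is_linear_scal_r. exact Cmult_comm.
    - eapply Rle_trans; [apply H; [easy|lra]|].
      apply Rle_trans with ((L + 1) * (eps / (L + 1))).
      + apply Rmult_le_compat; try lra. apply Rmin_r.
      + apply Req_le. field. lra. }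
  exists B. split; [exact B_hol|].
  intros x t Hx Ht eps Heps.
  set (y := F t x).
  assert (Hy : D y) by now apply F_self.
  destruct (HB y Hy) as [r [d [L [Hr [Hd [HL HBy]]]]]].
  set (M := norm (G t x) + 1).
  assert (HM : 1 <= M) by (pose proof (norm_ge_0 (G t x)); unfold M; lra).
  set (N := norm (B y) + 1).
  assert (HN : 1 <= N) by (pose proof (norm_ge_0 (B y)); unfold N; lra).
  (* Three errors of at most [eps / 4] each: the quotient against [B] at the moved point and the
     variation of [B], both multiplied by [G u x] of norm at most [M], and the variation of [G],
     multiplied by [B y] of norm at most [N]. *)
  assert (HeM : 0 < eps / (4 * M)) by (apply Rdiv_lt_0_compat; lra).
  assert (HeN : 0 < eps / (4 * N)) by (apply Rdiv_lt_0_compat; lra).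
  destruct (ex_filterdiff_continuous B y (eps / (4 * M)) (B_hol y Hy) HeM) as [r1 [Hr1 HB1]].
  destruct (F_luc t Ht x Hx) as [rF [HrF [_ HF]]].
  destruct (HF (Rmin r r1 / 2)) as [dF [HdF HF1]].
  { assert (0 < Rmin r r1) by now apply Rmin_glb_lt. lra. }
  destruct (locally_uniformly_continuous_of_0 t G_luc Ht x Hx) as [rG [HrG [_ HG]]].
  destruct (HG (Rmin 1 (eps / (4 * N)))) as [dG [HdG HG1]].
  { apply Rmin_glb_lt; lra. }
  assert (Hxx : norm (minus x x) = 0).
  { replace (minus x x) with (zero : X) by module_eq X. apply norm_zero. }
  set (dL := eps / (4 * M) / (L + 1)).
  assert (HdL : 0 < dL) by (apply Rdiv_lt_0_compat; lra).
  exists (Rmin (Rmin dF dG) (Rmin d dL)). split; [repeat apply Rmin_glb_lt; easy|].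
  intros s Hs Hst Hsd.
  apply Rmin_Rgt_l in Hsd. destruct Hsd as [Hsd1 Hsd2].
  apply Rmin_Rgt_l in Hsd1. destruct Hsd1 as [HsF HsG].
  apply Rmin_Rgt_l in Hsd2. destruct Hsd2 as [Hsd HsL].
  set (u := Rmin s t). set (h := Rabs (s - t)).
  assert (Hh : 0 < h) by (apply Rabs_pos_lt; lra).
  assert (Hu : 0 <= u) by (unfold u; now apply Rmin_glb).
  assert (Hut : Rabs (u - t) <= Rabs (s - t)).
  { unfold u, Rmin. destruct (Rle_dec s t); [lra|]. rewrite Rminus_diag, Rabs_R0.
    apply Rabs_pos. }
  assert (HFu : norm (minus (F u x) y) < Rmin r r1).
  { specialize (HF1 u x Hu ltac:(lra) ltac:(lra)).
    assert (0 < Rmin r r1) by now apply Rmin_glb_lt. fold y in HF1. lra. }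
  assert (HGu : norm (minus (G u x) (G t x)) <= Rmin 1 (eps / (4 * N))).
  { apply HG1; lra. }
  apply Rmin_Rgt_l in HFu. destruct HFu as [HFu1 HFu2].
  pose proof (Rmin_l 1 (eps / (4 * N))) as HGu1.
  pose proof (Rmin_r 1 (eps / (4 * N))) as HGu2.
  assert (HGM : norm (G u x) <= M).
  { pose proof (norm_le_minus (G u x) (G t x)). unfold M. lra. }
  assert (E : scal (RtoC (/ (s - t)) : C_AbsRing) (minus (G s x) (G t x))
    = mul (quot h (F u x)) (G u x)).
  { unfold quot. rewrite mul_scal_l, <- cocycle_increment by (easy || lra).
    unfold u, h, Rmin. destruct (Rle_dec s t) as [Hle|Hlt].
    - rewrite Rabs_left by lra. replace (s + - (s - t)) with t by ring.
      module_eq_in A; C_eq; lra.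
    - rewrite Rabs_right by lra. now replace (t + (s - t)) with s by ring. }
  rewrite E.
  set (q := quot h (F u x)). set (g := G u x) in *. fold y. set (b := B y) in *.
  set (b' := B (F u x)).
  assert (H1 : norm (mul (minus q b') g) < eps / (4 * M) * M).
  { eapply Rle_lt_trans; [apply norm_mul|].
    apply Rle_lt_trans with (norm (minus q b') * M).
    - apply Rmult_le_compat_l; [apply norm_ge_0|easy].
    - apply Rmult_lt_compat_r; [lra|].
      eapply Rle_lt_trans; [apply (HBy (F u x) HFu1); split; [easy|unfold h; lra]|].
      apply Rle_lt_trans with ((L + 1) * h); [apply Rmult_le_compat_r; lra|].
      unfold dL in HsL. fold h in HsL. apply (Rmult_lt_compat_l (L + 1)) in HsL; [|lra].
      replace ((L + 1) * (eps / (4 * M) / (L + 1))) with (eps / (4 * M)) in HsL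
        by (field; lra). easy. }
  assert (H2 : norm (mul (minus b' b) g) <= eps / (4 * M) * M).
  { eapply Rle_trans; [apply norm_mul|].
    apply Rmult_le_compat; try apply norm_ge_0; [|easy].
    apply Rlt_le. exact (HB1 (F u x) HFu2). }
  assert (H3 : norm (mul b (minus g (G t x))) <= N * (eps / (4 * N))).
  { eapply Rle_trans; [apply norm_mul|].
    apply Rmult_le_compat; try apply norm_ge_0; [unfold N; lra|].
    eapply Rle_trans; [exact HGu|easy]. }
  replace (eps / (4 * M) * M) with (eps / 4) in H1, H2 by (field; lra).
  replace (N * (eps / (4 * N))) with (eps / 4) in H3 by (field; lra).
  assert (H4 : norm (minus (mul q g) (mul b (G t x))) <=
    norm (plus (mul (minus q b') g) (mul (minus b' b) g)) + norm (mul b (minus g (G t x)))).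
  { apply norm_le_plus. rewrite !mul_minus_l, mul_minus_r. module_eq A. }
  assert (H5 : norm (plus (mul (minus q b') g) (mul (minus b' b) g)) <=
    norm (mul (minus q b') g) + norm (mul (minus b' b) g)) by now apply norm_le_plus.
  eapply Rle_lt_trans; [exact H4|]. lra.
Qed.
End Cocycle.

(** * From the definitions by filters and distances to statements on balls *)

Lemma small_ball_strictly_inside {X : BanachSpace} (D : X -> Prop) (x0 : X) :
  open D -> D x0 ->
  exists r, 0 < r /\ strictly_inside D (fun x => norm (minus x x0) < r).
Proof.
  intros HD Hx0.
  destruct (locally_ball_norm (X := X) x0 D (HD x0 Hx0)) as [d [Hd Hball]].
  exists (d / 2). split; [lra|]. split; [|split].
  - intros x Hx. apply Hball. apply Rlt_trans with (d / 2); [exact Hx|lra].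
  - exists (d / 2 + norm x0). intros x Hx.
    eapply Rle_trans; [apply (norm_le_minus (Y := X) x x0)|].
    apply Rplus_le_compat_r, Rlt_le, Hx.
  - unfold Rbar_glb. destruct (Rbar_ex_glb _) as [g Hg]; cbn [proj1_sig].
    apply (Rbar_lt_le_trans _ (d / 2)); [simpl; lra|].
    apply Hg. intros _ [x [Hx ->]].
    apply Glb_Rbar_correct. intros _ [y [Hy ->]]. simpl.
    (* A boundary point closer than [d / 2] to [x] would lie in [D]; but [D] is then a neighbourhood
       of it, which would have to contain a point outside [D]. *)
    apply Rnot_lt_le. intros Hxy.
    assert (HDy : D y).
    { apply Hball. apply Rlt_le_trans with (d / 2 + d / 2); [|lra].
      eapply Rle_lt_trans; [apply (norm_minus_triangle (Y := X) y x x0)|].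
      apply Rplus_lt_compat; [|exact Hx].
      eapply Rle_lt_trans; [apply Req_le, (norm_minus_sym (Y := X))|exact Hxy]. }
    destruct (Hy D (HD y HDy)) as [_ [z [Hz Hz']]]. contradiction.
Qed.

Lemma at_time_iff (t0 : R) (P : R -> Prop) :
  at_time t0 P <-> exists d, 0 < d /\ forall t, 0 <= t -> Rabs (t - t0) < d -> P t.
Proof.
  split.
  - intros [d H]. exists d; split; [apply cond_pos|]. intros t Ht Htd. now apply (H t).
  - intros [d [Hd H]]. exists (mkposreal d Hd). intros t Htd Ht. now apply H.
Qed.

Lemma T_continuous_locally_uniformly {X Y : BanachSpace}
    (D : X -> Prop) (f : R -> X -> Y) (t0 : R) :
  open D -> T_continuous D f -> 0 <= t0 ->
  locally_uniformly_continuous_at (X := X) (Y := Y) D f t0.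
Proof.
  intros HD [_ Hf] Ht0 x0 Hx0.
  destruct (small_ball_strictly_inside D x0 HD Hx0) as [r [Hr HE]].
  exists r. split; [easy|]. split; [apply HE|].
  intros eps Heps.
  destruct (proj1 (at_time_iff _ _) (Hf t0 Ht0 _ HE (mkposreal eps Heps))) as [d [Hd H]].
  exists d. split; [easy|]. intros t x Ht Htd Hx. exact (H t Ht Htd x Hx).
Qed.

Lemma uniformly_jointly_continuous_iff {X Y : BanachSpace} (D : X -> Prop) (f : R -> X -> Y) :
  (forall t, 0 <= t -> forall x, D x -> continuous (f t) x) ->
  uniformly_jointly_continuous D f <->
  forall t0, 0 <= t0 -> locally_uniformly_continuous_at (X := X) (Y := Y) D f t0.
Proof.
  intros Hc. split.
  - intros [_ Hf] t0 Ht0 x0 Hx0.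
    destruct (Hf t0 x0 Ht0 Hx0) as [U [HU [HUD HfU]]].
    destruct (locally_ball_norm (X := X) x0 U HU) as [r [Hr HrU]].
    exists r. split; [easy|]. split; [intros x Hx; now apply HUD, HrU|].
    intros eps Heps.
    destruct (proj1 (at_time_iff _ _) (HfU (mkposreal eps Heps))) as [d [Hd H]].
    exists d. split; [easy|]. intros t x Ht Htd Hx. exact (H t Ht Htd x (HrU x Hx)).
  - intros H. split; [easy|]. intros t0 x0 Ht0 Hx0.
    destruct (H t0 Ht0 x0 Hx0) as [r [Hr [HrD Hf]]].
    exists (fun x => norm (minus x x0) < r). split; [|split].
    + now apply (ball_norm_locally (X := X) x0 _ r).
    + exact HrD.
    + intros eps. apply at_time_iff. destruct (Hf eps (cond_pos eps)) as [d [Hd Hd']].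
      exists d. split; [easy|]. intros t Ht Htd x Hx. exact (Hd' t x Ht Htd Hx).
Qed.

(** The axioms of semigroups and semicocycles prescribe the limit as [t -> 0+]; continuity of the
    family at time 0 turns it into the value at time 0. *)
Lemma value_at_0 {X Y : NormedModule C_AbsRing} (D : X -> Prop) (f : R -> X -> Y) (x : X) (y : Y) :
  locally_uniformly_continuous_at D f 0 -> D x ->
  filterlim (fun t => f t x) (at_right 0) (locally y) -> f 0 x = y.
Proof.
  intros Hf Hx Hy.
  apply (filterlim_locally_unique (F := at_right 0) (fun t => f t x)); [|exact Hy].
  apply filterlim_locally_ball_norm. intros eps.
  destruct (Hf x Hx) as [r [Hr [_ H]]].
  destruct (H (eps / 2)) as [d [Hd Hd']]; [pose proof (cond_pos eps); lra|].
  exists (mkposreal d Hd). intros t Htd Ht. unfold ball_norm.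
  apply Rle_lt_trans with (eps / 2); [|pose proof (cond_pos eps); lra].
  apply Hd'; [lra|exact Htd|].
  replace (minus x x) with (zero : X) by module_eq X. now rewrite norm_zero.
Qed.

Lemma is_derive_halfline_iff {Y : BanachSpace} (v : R -> Y) (t : R) (l : Y) :
  is_derive_halfline v t l <->
  forall eps, 0 < eps -> exists d, 0 < d /\ forall s, 0 <= s -> s <> t -> Rabs (s - t) < d ->
    norm (minus (scal (RtoC (/ (s - t)) : C_AbsRing) (minus (v s) (v t))) l) < eps.
Proof.
  unfold is_derive_halfline. split.
  - intros H eps Heps.
    destruct (proj1 (filterlim_locally_ball_norm (U := Y) _ l) H (mkposreal eps Heps)) as [d Hd].
    exists d. split; [apply cond_pos|]. intros s Hs Hst Hsd. now apply Hd.
  - intros H. apply (filterlim_locally_ball_norm (U := Y)). intros eps.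
    destruct (H eps (cond_pos eps)) as [d [Hd Hd']].
    exists (mkposreal d Hd). intros s Hsd Hst Hs. now apply Hd'.
Qed.

Theorem theorem5p1
    (X : BanachSpace) (A : UnitalBanachAlgebra)
    (D : X -> Prop) (F : R -> X -> X) (Gamma : R -> X -> A)
    (D_domain : domain D) (D_bounded : bounded_set D)
    (F_hol : forall t, 0 <= t -> holomorphic D (F t))
    (F_semigroup : semigroup D F)
    (F_Tcont : T_continuous D F)
    (Gamma_hol : forall t, 0 <= t -> holomorphic D (Gamma t))
    (Gamma_semicocycle : semicocycle D F Gamma) :
  (exists B : X -> A, holomorphic D B /\ generated_by D F Gamma B) <->
  uniformly_jointly_continuous D Gamma.
Proof.
  destruct F_semigroup as [F_self [_ [F_plus F_lim]]].
  destruct Gamma_semicocycle as [G_mul G_lim].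
  destruct D_domain as [_ [D_open _]].
  set (XN := CompleteNormedModule.NormedModule C_AbsRing X).
  set (AN := CompleteNormedModule.NormedModule C_AbsRing A).
  assert (F_luc : forall t, 0 <= t ->
    locally_uniformly_continuous_at (X := XN) (Y := XN) D F t).
  { intros t Ht. now apply T_continuous_locally_uniformly. }
  assert (F_0 : forall x, D x -> F 0 x = x).
  { intros x Hx. apply (value_at_0 (X := XN) (Y := XN) D F x x); auto. apply F_luc; lra. }
  rewrite uniformly_jointly_continuous_iff.
  2: { intros t Ht x Hx. apply (filterdiff_continuous (U := XN) (V := AN)).
       now apply Gamma_hol. }
  assert (mul_one_l : forall a : AN, amul aone a = a) by (intros a; apply Ring.ax3).
  assert (mul_one_r : forall a : AN, amul a aone = a) by (intros a; apply Ring.ax2).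
  assert (mul_plus_l : forall a b c : AN, amul (plus a b) c = plus (amul a c) (amul b c))
    by (intros a b c; apply Ring.ax4).
  assert (mul_plus_r : forall a b c : AN, amul a (plus b c) = plus (amul a b) (amul a c))
    by (intros a b c; apply Ring.ax5).
  assert (G_plus : forall t s x, 0 <= t -> 0 <= s -> D x ->
    Gamma (t + s) x = amul (Gamma t (F s x)) (Gamma s x))
    by (intros t s x Ht Hs Hx; symmetry; auto).
  assert (mul_scal_l : forall (k : C) (a b : AN),
    amul (scal (k : C_AbsRing) a) b = scal (k : C_AbsRing) (amul a b))
    by (intros k a b; apply scal_mult_l).
  assert (norm_mul : forall a b : AN, norm (amul a b) <= norm a * norm b)
    by (intros a b; apply norm_mult).
  assert (F_self' : forall t x, 0 <= t -> D x -> D (F t x))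
    by (intros t x Ht Hx; now apply F_self).
  assert (F_plus' : forall t s x, 0 <= t -> 0 <= s -> D x -> F (t + s) x = F t (F s x))
    by (intros t s x Ht Hs Hx; now apply F_plus).
  assert (F_hol' : forall t (x : XN), 0 <= t -> D x ->
    ex_filterdiff (U := XN) (V := XN) (F t) (locally x))
    by (intros t x Ht Hx; now apply F_hol).
  assert (G_hol' : forall t (x : XN), 0 <= t -> D x ->
    ex_filterdiff (U := XN) (V := AN) (Gamma t) (locally x))
    by (intros t x Ht Hx; now apply Gamma_hol).
  split.
  - intros [B [B_hol HB]] t0 Ht0.
    (* In this direction the value at time 0 is the initial condition of the differential equation;
       in the converse it follows from joint continuity. *)
    assert (G_0 : forall x, D x -> Gamma 0 x = aone) by (intros x Hx; apply HB, Hx).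
    assert (Hgen : generates (X := XN) (A := AN) amul D F Gamma B).
    { intros x t Hx Ht.
      exact (proj1 (is_derive_halfline_iff (fun s => Gamma s x) t _) (proj2 (HB x Hx) t Ht)). }
    apply (locally_uniformly_continuous_of_0 (X := XN) (A := AN) amul aone mul_one_l mul_plus_l
      norm_mul D F Gamma F_self' G_0 G_plus F_hol' G_hol' F_luc t0); [|easy].
    exact (generated_locally_uniformly_continuous (X := XN) (A := AN) amul aone
      norm_mul (norm_unit A) D F Gamma F_0 G_0 F_luc B Hgen B_hol).
  - intros G_luc.
    assert (G_luc_0 : locally_uniformly_continuous_at (X := XN) (Y := AN) D Gamma 0)
      by (apply G_luc; lra).
    assert (G_0 : forall x, D x -> Gamma 0 x = aone).
    { intros x Hx. apply (value_at_0 (X := XN) (Y := AN) D Gamma x aone); auto. }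
    destruct (generator_exists (X := XN) (A := AN) amul aone mul_one_l mul_one_r mul_plus_l
      mul_plus_r mul_scal_l norm_mul D F Gamma F_self' F_0 G_0 F_plus' G_plus F_hol' G_hol' F_luc
      (banach_norm_complete A) G_luc_0) as [B [B_hol HB]].
    exists B. split; [exact B_hol|]. intros x Hx. split; [now apply G_0|].
    intros t Ht.
    exact (proj2 (is_derive_halfline_iff (fun s => Gamma s x) t _) (HB x t Hx Ht)).
Qed.
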